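(* Let $\mathcal{K}$ be the class of all circulant Deza graphs $\Gamma$ with $\mathrm{rk}_{\mathrm{WL}}(\Gamma)=4$. Then $\max_{\Gamma\in\mathcal{K}}\dim_{\mathrm{WL}}(\Gamma)=3$.
   Context: A coherent configuration on a finite set $V$ is a partition $\mathcal{R}$ of $V\times V$ such that the diagonal is a union of classes, $\mathcal{R}$ is closed under transposition of relations, and for all $r,s,t\in\mathcal{R}$ the number $|\{\gamma:(\alpha,\gamma)\in r,(\gamma,\beta)\in s\}|$ does not depend on $(\alpha,\beta)\in t$. The WL-closure of a graph $\Gamma=(V,E)$ is the coarsest coherent configuration on $V$ in which $E$ is a union of classes, and $\mathrm{rk}_{\mathrm{WL}}(\Gamma)$ is its number of classes. The WL-dimension $\dim_{\mathrm{WL}}(\Gamma)$ is the smallest positive integer $m$ such that the $m$-dimensional Weisfeiler–Leman algorithm identifies $\Gamma$ (distinguishes it from every non-isomorphic graph), in the convention where the $1$-dimensional algorithm is colour refinement and the $2$-dimensional one is the classical Weisfeiler–Leman algorithm. A $k$-regular graph is a Deza graph if there are nonnegative integers $a,b$ such that every pair of distinct vertices has either $a$ or $b$ common neighbours. A circulant graph is a Cayley graph $\mathrm{Cay}(G,S)$ over a finite cyclic group $G$ with $e\notin S=S^{-1}$ (vertex set $G$, $g\sim sg$ for $s\in S$). *)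

(* Defs.v *)
From mathcomp Require Import all_boot.
Set Implicit Arguments. Unset Strict Implicit. Unset Printing Implicit Defensive.

Definition simple_graph (V : finType) (e : rel V) : Prop :=
  (forall x y, e x y = e y x) /\ (forall x, ~~ e x x).

Definition graph_iso (V1 V2 : finType) (e1 : rel V1) (e2 : rel V2) : Prop :=
  exists h : V1 -> V2, bijective h /\ forall x y, e1 x y = e2 (h x) (h y).

Definition is_Deza (V : finType) (e : rel V) : Prop :=
  (exists k, forall x, #|[set y | e x y]| = k) /\
  exists a b : nat, forall x y, x != y ->
    #|[set z | e x z && e y z]| = a \/ #|[set z | e x z && e y z]| = b.

Definition circ_adj (n : nat) (S : {set 'I_n}) : rel 'I_n :=
  fun x y => [exists s in S, (s + x) %% n == (y : nat)].

Definition circ_conn (n : nat) (S : {set 'I_n}) : Prop :=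
  (forall s, s \in S -> (s : nat) != 0) /\
  (forall s, s \in S -> exists2 t, t \in S & (s + t) %% n = 0).

Definition transp (V : finType) (X : {set V * V}) : {set V * V} :=
  [set p | (p.2, p.1) \in X].

Definition diag_set (V : finType) : {set V * V} := [set p | p.1 == p.2].

Definition union_of_classes (V : finType) (P : {set {set V * V}}) (A : {set V * V}) :=
  forall X, X \in P -> (X \subset A) \/ [disjoint X & A].

Definition coherent_config (V : finType) (P : {set {set V * V}}) : Prop :=
  partition P [set: V * V] /\
  union_of_classes P (diag_set V) /\
  (forall X, X \in P -> transp X \in P) /\
  (forall r s t, r \in P -> s \in P -> t \in P ->
     forall a b a' b', (a, b) \in t -> (a', b') \in t ->
       #|[set g | ((a, g) \in r) && ((g, b) \in s)]| =
       #|[set g | ((a', g) \in r) && ((g, b') \in s)]|).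

Definition edge_set (V : finType) (e : rel V) : {set V * V} := [set p | e p.1 p.2].

Definition refines (V : finType) (Q P : {set {set V * V}}) : Prop :=
  forall Y, Y \in Q -> exists2 X, X \in P & Y \subset X.

Definition is_WL_closure (V : finType) (e : rel V) (P : {set {set V * V}}) : Prop :=
  coherent_config P /\ union_of_classes P (edge_set e) /\
  forall Q, coherent_config Q -> union_of_classes Q (edge_set e) -> refines Q P.

(* rk_WL(Gamma) = r  (the WL-closure is unique) *)
Definition WL_rank_is (V : finType) (e : rel V) (r : nat) : Prop :=
  exists P, is_WL_closure e P /\ #|P| = r.

Definition upd (V : finType) (m : nat) (u : {ffun 'I_m -> V}) (j : 'I_m) (w : V)
  : {ffun 'I_m -> V} := [ffun i => if i == j then w else u i].

(* wl_eq k u v : the colour of the m-tuple u of Gamma1 after k rounds equals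
   the colour of the m-tuple v of Gamma2 after k rounds, where colours are
   (canonical, graph-independent):
     round 0 : the atomic (isomorphism) type of the tuple;
     round k+1 : (old colour,
                  multiset over w of (atp(u w), c(u[1<-w]), ..., c(u[m<-w]))).
   Equality of multisets is expressed by a bijection between vertex sets.
   For m = 1 this is colour refinement, for m = 2 the classical WL algorithm. *)
Fixpoint wl_eq (V1 V2 : finType) (e1 : rel V1) (e2 : rel V2) (m k : nat)
  (u : {ffun 'I_m -> V1}) (v : {ffun 'I_m -> V2}) {struct k} : Prop :=
  match k with
  | 0 => forall i j, (u i == u j) = (v i == v j) /\ e1 (u i) (u j) = e2 (v i) (v j)
  | k'.+1 =>
      wl_eq e1 e2 k' u v /\
      exists f : V1 -> V2, bijective f /\
        forall w : V1,
          (forall i, (u i == w) = (v i == f w) /\ e1 (u i) w = e2 (v i) (f w)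
                     /\ e1 w (u i) = e2 (f w) (v i)) /\
          (forall j, wl_eq e1 e2 k' (upd u j w) (upd v j (f w)))
  end.

Definition wl_distinguishes (V1 V2 : finType) (e1 : rel V1) (e2 : rel V2) (m : nat) : Prop :=
  exists k, ~ exists g : {ffun 'I_m -> V1} -> {ffun 'I_m -> V2},
      bijective g /\ forall u, wl_eq e1 e2 k u (g u).

Definition wl_identifies (V : finType) (e : rel V) (m : nat) : Prop :=
  forall (V' : finType) (e' : rel V'), simple_graph e' -> ~ graph_iso e e' ->
    wl_distinguishes e e' m.

Definition WL_dim_is (V : finType) (e : rel V) (m : nat) : Prop :=
  0 < m /\ wl_identifies e m /\ forall m', 0 < m' < m -> ~ wl_identifies e m'.

(* Main.v *)
(* Upper bound. Let c be the colouring of Z_N by the classes of the WL-closure. If N is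
   composite, Frobenius on circulant matrices modulo a prime divisor of N yields an
   invariant subgroup, and with rank 4 this leaves three shapes for c: a chain
   0 <= L <= U <= Z_N with monochromatic layers, a direct decomposition H + K, or a
   section U/L of prime order carrying all the structure. The first two are recovered
   from their equivalence relations alone. For the third, fix one point of the graph:
   the invariant functions on pairs over F_p are then closed under convolution.
   Multipliers make (x - y)^d invariant for some 0 < d < p - 1; convolution over F_p^*
   acts coefficientwise on polynomials in t = y/x, so (1 - t)^d can be replaced by
   1 + t + ... + t^d, which together with t^d determines t unless t^d = 1, and such t
   are products of two others. Hence, after fixing two points, the colour of a third
   determines its coset, and the bijection played in the game is an isomorphism.

   Sharpness. In the lexicographic product of the Paley graph on 29 points with K_2, the
   Paley graph may be replaced by another strongly regular graph with the same parameters: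
   the 2-dimensional algorithm does not notice, but the number of edges in the common
   neighbourhood of an edge does. *)
Require Import Defs.
From mathcomp Require Import all_boot all_algebra all_field.
From mathcomp Require Import zify ring.
From mathcomp Require Import boolp.

Set Implicit Arguments.
Unset Strict Implicit.
Unset Printing Implicit Defensive.

(** * The pebble game and coherent configurations *)

(** Two fixed points use up two of the three pebbles, so the image of an edge ab cannot be inspected
    while both stay on the board. The second fixed point therefore serves only to pin down cosets:
    it is lifted to look at the edge, and composing the two positions shows that b has moved at most
    inside its coset, where adjacency does not change. The hard case of the classification is an
    invariant subgroup with an outer coset carrying two colours: Frobenius alone does not settle it,
    and double counting over the cosets is needed to leave only a direct decomposition. In the
    example, passing to the lexicographic product adds the twin relation to the three classes of the
    Paley scheme, which gives rank 4. The order 29 is the first prime for which the Paley graph is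
    not determined by its parameters as a strongly regular graph. *)

Lemma card_fibers (X T : finType) (k : X -> T) :
  #|X| = \sum_t #|[set x | k x == t]|.
Proof.
rewrite -sum1_card (partition_big k xpredT) //=; apply: eq_bigr => t _.
by rewrite -sum1_card; apply: eq_bigl => x; rewrite inE.
Qed.

(** Points of matching fibres are paired by their positions in the enumerations. This turns equal
    counts into the bijections that the game asks for. *)
Lemma fun_of_fibers (A B T : finType) (f : A -> T) (g : B -> T) :
  (forall t, #|[set a | f a == t]| = #|[set b | g b == t]|) ->
  exists2 h : A -> B, bijective h & forall a, g (h a) = f a.
Proof.
move=> cardFG.
pose F t := [set a | f a == t]; pose G t := [set b | g b == t].
have Ff a : a \in enum (F (f a)) by rewrite mem_enum inE.
have rk_lt a : index a (enum (F (f a))) < size (enum (G (f a))).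
  by rewrite -!cardE -cardFG cardE index_mem.
have cardAB : #|A| = #|B|.
  by rewrite (card_fibers f) (card_fibers g); apply: eq_bigr => t _; apply: cardFG.
case: (pickP (xpredT : pred B)) => [b0 _|B0]; last first.
  have A0 (a : A) : False.
    have: #|A| = 0 by rewrite cardAB; apply: eq_card0.
    by move/fintype0 => /(_ a).
  have B1 (b : B) : False by have := B0 b.
  exists (fun a => match A0 a with end) => [|a]; last by case: (A0 a).
  by exists (fun b => match B1 b with end) => [a|b]; [case: (A0 a)|case: (B1 b)].
pose h a := nth b0 (enum (G (f a))) (index a (enum (F (f a)))).
have gh a : g (h a) = f a.
  by apply/eqP; have := mem_nth b0 (rk_lt a); rewrite mem_enum inE.
exists h => //; apply: inj_card_bij; last by rewrite cardAB.
move=> a b hab; have fab : f a = f b by rewrite -!gh hab.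
have /eqP := hab; rewrite /h -fab nth_uniq ?enum_uniq ?rk_lt //; last first.
  by rewrite fab rk_lt.
move/eqP => eqi; rewrite -[a](nth_index a (Ff a)) eqi nth_index //.
by rewrite fab.
Qed.

(** Compactness: if each candidate [t] failed at some round [K t], none could survive the maximum of
    these finitely many rounds. One bijection per round thus becomes a single bijection for all
    rounds. *)
Lemma finite_descending (T : finType) (W : nat -> T -> Prop) :
  (forall k t, W k.+1 t -> W k t) -> (forall k, exists t, W k t) ->
  exists t, forall k, W k t.
Proof.
move=> Wdec Wex; apply: contrapT => /forallNP noW.
have /choice[K KP] : forall t, exists k, ~ W k t by move=> t; apply/existsNP/noW.
have [t Wt] := Wex (\max_t K t); apply: (KP t).
rewrite -(subnK (leq_bigmax t : K t <= \max_t K t)) in Wt.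
by elim: (_ - _) Wt => // d IH /Wdec.
Qed.

Definition wl_sim (V1 V2 : finType) (e1 : rel V1) (e2 : rel V2) m
    (u : {ffun 'I_m -> V1}) (v : {ffun 'I_m -> V2}) : Prop :=
  forall k, wl_eq e1 e2 k u v.

Section WLSim.
Variables (V1 V2 : finType) (e1 : rel V1) (e2 : rel V2) (m : nat).
Implicit Types (u : {ffun 'I_m -> V1}) (v : {ffun 'I_m -> V2}).

Lemma wl_sim_atom u v i j : wl_sim e1 e2 u v ->
  (u i == u j) = (v i == v j) /\ e1 (u i) (u j) = e2 (v i) (v j).
Proof. by move/(_ 0); apply. Qed.

Lemma wl_sim_step u v : wl_sim e1 e2 u v ->
  exists2 f : V1 -> V2, bijective f &
    forall w j, wl_sim e1 e2 (upd u j w) (upd v j (f w)).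
Proof.
move=> uv; pose W k (f : {ffun V1 -> V2}) := bijective f /\
  forall w j, wl_eq e1 e2 k (upd u j w) (upd v j (f w)).
have [k f [bij_f step_f]|k|f fP] := @finite_descending _ W.
- by split=> // w j; have [] := step_f w j.
- have [_ [f [bij_f fP]]] := uv k.+1; exists (finfun f); split.
    by apply: (eq_bij bij_f) => w; rewrite ffunE.
  by move=> w j; rewrite ffunE; have [_] := fP w; apply.
exists f; first by case: (fP 0).
by move=> w j k; case: (fP k).
Qed.

(** When pebble [j] moves onto pebble [i], the answer must be [v i], because equality of pebbles is
    part of the atomic type. *)
Lemma wl_sim_copy u v i j : i != j -> wl_sim e1 e2 u v ->
  wl_sim e1 e2 (upd u j (u i)) (upd v j (v i)).
Proof.
move=> ij uv; have [f bij_f fP] := wl_sim_step uv.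
have := fP (u i) j => sim; have [+ _] := wl_sim_atom i j sim.
rewrite !ffunE (negbTE ij) !eqxx => /esym/eqP ->.
exact: fP.
Qed.

Lemma not_distinguished : ~ wl_distinguishes e1 e2 m ->
  exists2 g : {ffun 'I_m -> V1} -> {ffun 'I_m -> V2}, bijective g &
    forall u, wl_sim e1 e2 u (g u).
Proof.
move=> /forallNP nd.
pose W k (g : {ffun {ffun 'I_m -> V1} -> {ffun 'I_m -> V2}}) := bijective g /\
  forall u, wl_eq e1 e2 k u (g u).
have [k g [bij_g gP]|k|g gP] := @finite_descending _ W.
- by split=> // u; have [] := gP u.
- have /contrapT[g [bij_g gP]] := nd k; exists (finfun g); split.
    by apply: (eq_bij bij_g) => w; rewrite ffunE.
  by move=> u; rewrite ffunE.
exists g; first by case: (gP 0).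
by move=> u k; case: (gP k).
Qed.

End WLSim.

Lemma wl_eq_sym (V1 V2 : finType) (e1 : rel V1) (e2 : rel V2) m k
    (u : {ffun 'I_m -> V1}) (v : {ffun 'I_m -> V2}) :
  wl_eq e1 e2 k u v -> wl_eq e2 e1 k v u.
Proof.
elim: k u v => [|k IH] u v /=; first by move=> uv i j; have [-> ->] := uv i j.
case=> uv [f [bij_f fP]]; split; first exact: IH.
have [g fK gK] := bij_f; exists g; split; first by exists f.
move=> w; have [at_w step_w] := fP (g w); rewrite !gK in at_w step_w.
split=> [i|j]; last exact: IH.
by have [-> [-> ->]] := at_w i.
Qed.

Lemma wl_eq_trans (V1 V2 V3 : finType) (e1 : rel V1) (e2 : rel V2) (e3 : rel V3)
    m k (u : {ffun 'I_m -> V1}) (v : {ffun 'I_m -> V2}) (w : {ffun 'I_m -> V3}) :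
  wl_eq e1 e2 k u v -> wl_eq e2 e3 k v w -> wl_eq e1 e3 k u w.
Proof.
elim: k u v w => [|k IH] u v w /=.
  by move=> uv vw i j; have [-> ->] := uv i j; apply: vw.
case=> uv [f [bij_f fP]] [vw [g [bij_g gP]]]; split; first exact: IH uv vw.
exists (g \o f); split; first exact: bij_comp.
move=> x; have [at1 st1] := fP x; have [at2 st2] := gP (f x).
split=> [i|j] /=; last exact: IH (st1 j) (st2 j).
by have [-> [-> ->]] := at1 i; apply: at2.
Qed.

Lemma wl_sim_sym (V1 V2 : finType) (e1 : rel V1) (e2 : rel V2) m
    (u : {ffun 'I_m -> V1}) (v : {ffun 'I_m -> V2}) :
  wl_sim e1 e2 u v -> wl_sim e2 e1 v u.
Proof. by move=> uv k; apply: wl_eq_sym. Qed.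

Lemma wl_sim_trans (V1 V2 V3 : finType) (e1 : rel V1) (e2 : rel V2) (e3 : rel V3)
    m (u : {ffun 'I_m -> V1}) (v : {ffun 'I_m -> V2}) (w : {ffun 'I_m -> V3}) :
  wl_sim e1 e2 u v -> wl_sim e2 e3 v w -> wl_sim e1 e3 u w.
Proof. by move=> uv vw k; apply: wl_eq_trans (uv k) (vw k). Qed.

Lemma wl_sim_auto (V : finType) (e : rel V) m (a : V -> V) (u : {ffun 'I_m -> V}) :
  bijective a -> (forall x y, e (a x) (a y) = e x y) ->
  wl_sim e e u [ffun i => a (u i)].
Proof.
move=> bij_a ea k; have inj_a := bij_inj bij_a.
elim: k u => [|k IH] u /=; first by move=> i j; rewrite !ffunE ea (inj_eq inj_a).
split; first exact: IH.
exists a; split=> // w; split=> [i|j]; first by rewrite !ffunE !ea (inj_eq inj_a).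
rewrite (_ : upd _ j (a w) = [ffun i => a (upd u j w i)]); first exact: IH.
by apply/ffunP=> i; rewrite !ffunE; case: ifP.
Qed.

Definition triple (V : finType) (x y z : V) : {ffun 'I_3 -> V} :=
  [ffun i : 'I_3 => if val i == 0 then x else if val i == 1 then y else z].

Definition sim3 (V1 V2 : finType) (e1 : rel V1) (e2 : rel V2) x y z x' y' z' :=
  wl_sim e1 e2 (triple x y z) (triple x' y' z').

Section Sim3.
Variables (V1 V2 : finType) (e1 : rel V1) (e2 : rel V2).

Let i0 : 'I_3 := @Ordinal 3 0 isT.
Let i1 : 'I_3 := @Ordinal 3 1 isT.
Let i2 : 'I_3 := @Ordinal 3 2 isT.

Lemma updt0 (V : finType) (x y z w : V) : upd (triple x y z) i0 w = triple w y z.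
Proof. by apply/ffunP=> -[[|[|[|]]] lti] //; rewrite !ffunE. Qed.
Lemma updt1 (V : finType) (x y z w : V) : upd (triple x y z) i1 w = triple x w z.
Proof. by apply/ffunP=> -[[|[|[|]]] lti] //; rewrite !ffunE. Qed.
Lemma updt2 (V : finType) (x y z w : V) : upd (triple x y z) i2 w = triple x y w.
Proof. by apply/ffunP=> -[[|[|[|]]] lti] //; rewrite !ffunE. Qed.

Lemma sim3_step x y z x' y' z' : sim3 e1 e2 x y z x' y' z' ->
  exists2 f : V1 -> V2, bijective f & forall w,
    [/\ sim3 e1 e2 w y z (f w) y' z', sim3 e1 e2 x w z x' (f w) z'
      & sim3 e1 e2 x y w x' y' (f w)].
Proof.
move=> /wl_sim_step[f bij_f fP]; exists f => // w; rewrite /sim3.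
by split; [have := fP w i0|have := fP w i1|have := fP w i2];
  rewrite ?updt0 ?updt1 ?updt2.
Qed.

Lemma sim3_atom x y z x' y' z' : sim3 e1 e2 x y z x' y' z' ->
  [/\ (x == y) = (x' == y'), (x == z) = (x' == z') & (y == z) = (y' == z')].
Proof.
move=> s; have [a _] := wl_sim_atom i0 i1 s; have [b _] := wl_sim_atom i0 i2 s.
by have [c _] := wl_sim_atom i1 i2 s; rewrite !ffunE in a b c.
Qed.

Lemma sim3_edge x y z x' y' z' : sim3 e1 e2 x y z x' y' z' ->
  e1 y z = e2 y' z'.
Proof. by move=> s; have [_] := wl_sim_atom i1 i2 s; rewrite !ffunE. Qed.

Lemma sim3_copy x y z x' y' z' : sim3 e1 e2 x y z x' y' z' ->
  [/\ sim3 e1 e2 y y z y' y' z', sim3 e1 e2 z y z z' y' z',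
      sim3 e1 e2 x x z x' x' z' , sim3 e1 e2 x z z x' z' z' &
      sim3 e1 e2 x y x x' y' x' /\ sim3 e1 e2 x y y x' y' y'].
Proof.
move=> s; rewrite /sim3; split; last split.
- by have := wl_sim_copy (i := i1) (j := i0) isT s; rewrite !updt0 !ffunE.
- by have := wl_sim_copy (i := i2) (j := i0) isT s; rewrite !updt0 !ffunE.
- by have := wl_sim_copy (i := i0) (j := i1) isT s; rewrite !updt1 !ffunE.
- by have := wl_sim_copy (i := i2) (j := i1) isT s; rewrite !updt1 !ffunE.
- by have := wl_sim_copy (i := i0) (j := i2) isT s; rewrite !updt2 !ffunE.
- by have := wl_sim_copy (i := i1) (j := i2) isT s; rewrite !updt2 !ffunE.
Qed.

Hypothesis nd : ~ wl_distinguishes e1 e2 3.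

Lemma sim3_cover x' y' z' : exists x y z, sim3 e1 e2 x y z x' y' z'.
Proof.
have [g [h gK hK] gP] := not_distinguished nd.
pose t := h (triple x' y' z'); exists (t i0), (t i1), (t i2).
rewrite /sim3 -(hK (triple x' y' z')) -/t.
rewrite (_ : triple (t i0) _ _ = t) //; apply/ffunP=> i; rewrite ffunE.
by case: i => -[|[|[|]]] lti //=; congr (t _); apply: val_inj.
Qed.

Lemma sim3_diag_cover x' : exists x, sim3 e1 e2 x x x x' x' x'.
Proof.
have [x [y [z s]]] := sim3_cover x' x' x'; have [] := sim3_atom s.
by rewrite !eqxx => /eqP exy /eqP exz _; exists x; subst y z.
Qed.

Lemma sim3_diag x : exists x', sim3 e1 e2 x x x x' x' x'.
Proof.
have [g _ gP] := not_distinguished nd; pose t := g (triple x x x).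
have s := gP (triple x x x); exists (t i0).
have [a _] := wl_sim_atom i0 i1 s; have [b _] := wl_sim_atom i0 i2 s.
rewrite !ffunE !eqxx -/t in a b.
rewrite /sim3; suff -> : triple (t i0) (t i0) (t i0) = t by exact: s.
apply/ffunP=> i; rewrite ffunE /=; case: ifP => [/eqP|]; last case: ifP => /eqP.
- by move=> i_0; congr (t _); apply: val_inj; rewrite /= i_0.
- by move=> i_1 _; rewrite (eqP (esym a)); congr (t _); apply: val_inj; rewrite /= i_1.
case: i => -[|[|[|]]] //= lti _ _; rewrite (eqP (esym b)).
by congr (t _); apply: val_inj.
Qed.

End Sim3.

Lemma sim3_sym (V1 V2 : finType) (e1 : rel V1) (e2 : rel V2) x y z x' y' z' :
  sim3 e1 e2 x y z x' y' z' -> sim3 e2 e1 x' y' z' x y z.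
Proof. exact: wl_sim_sym. Qed.

Lemma sim3_trans (V1 V2 V3 : finType) (e1 : rel V1) (e2 : rel V2) (e3 : rel V3)
    x y z x' y' z' x2 y2 z2 :
  sim3 e1 e2 x y z x' y' z' -> sim3 e2 e3 x' y' z' x2 y2 z2 ->
  sim3 e1 e3 x y z x2 y2 z2.
Proof. exact: wl_sim_trans. Qed.

Section CoherentRel.
Variables (V : finType) (R : rel (V * V)).

(** Intersection numbers are replaced by an injection carrying the triangles over one pair to those
    over the other. Automorphisms and game strategies supply such maps directly, and exchanging the
    two pairs gives the reverse inequality. *)
Definition coherent_rel : Prop :=
  [/\ equivalence_rel R,
      forall p q, R p q -> (p.1 == p.2) = (q.1 == q.2),
      forall x y x2 y2, R (x, y) (x2, y2) -> R (y, x) (y2, x2)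
    & forall x y x2 y2, R (x, y) (x2, y2) -> exists2 f : V -> V, injective f &
        forall w, R (x, w) (x2, f w) /\ R (w, y) (f w, y2)].

Hypothesis cR : coherent_rel.
Let P := equivalence_partition R [set: V * V].

Let Rxx p : R p p. Proof. by case: cR => eqR _ _ _; have [] := eqR p p p. Qed.
Let Rsym p q : R p q = R q p.
Proof. by case: cR => /equivalence_relP[_ Rl] _ _ _; apply/idP/idP => /Rl <-. Qed.
Let Rtrans p q r : R p q -> R q r -> R p r.
Proof. by case: cR => /equivalence_relP[_ Rl] _ _ _ /Rl ->. Qed.

Lemma coherent_rel_class X p : X \in P -> p \in X -> X = [set q | R p q].
Proof.
case/imsetP=> p0 _ ->; rewrite !inE /= => Rp; apply/setP=> q; rewrite !inE /=.
apply/idP/idP; first by apply: Rtrans; rewrite Rsym.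
exact: Rtrans.
Qed.

Lemma coherent_rel_union (A : {set V * V}) :
  (forall p q, R p q -> (p \in A) = (q \in A)) -> union_of_classes P A.
Proof.
move=> RA X /imsetP[p _ ->]; have [pA|pA] := boolP (p \in A); [left|right].
  by apply/subsetP=> q; rewrite !inE /= => /RA <-.
rewrite disjoint_subset; apply/subsetP=> q; rewrite !inE /= => /RA <- //.
Qed.

Lemma coherent_rel_config : coherent_config P.
Proof.
have [eqR Rd Rt Rf] := cR; split.
  by apply: equivalence_partitionP => p q r _ _ _; apply: eqR.
split; first by apply: coherent_rel_union => p q /Rd; rewrite !inE.
split.
  move=> X /imsetP[[x y] _ ->]; apply/imsetP; exists (y, x) => //.
  apply/setP=> -[u v]; rewrite !inE /=; apply/idP/idP; exact: Rt.
move=> r s t rP sP tP.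
suff le a b a' b' : (a, b) \in t -> (a', b') \in t ->
    #|[set g | ((a, g) \in r) && ((g, b) \in s)]| <=
    #|[set g | ((a', g) \in r) && ((g, b') \in s)]|.
  by move=> a b a' b' abt ab't; apply/eqP; rewrite eqn_leq !le.
move=> abt; rewrite (coherent_rel_class tP abt) inE => /Rf[f injf fR].
rewrite -(card_imset _ injf); apply/subset_leq_card/subsetP=> _ /imsetP[w + ->].
rewrite !inE => /andP[awr wbs]; have [R1 R2] := fR w.
by rewrite (coherent_rel_class rP awr) (coherent_rel_class sP wbs) !inE R1.
Qed.

(** The partition by [R] competes in the definition of the closure, hence refines it. This is
    applied to the orbits of the dihedral group and to the equivalence defined by the game. *)
Lemma wl_closure_coarse (e : rel V) Q : is_WL_closure e Q ->
  (forall x y x2 y2, R (x, y) (x2, y2) -> e x y = e x2 y2) ->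
  forall p q, R p q -> pblock Q p = pblock Q q.
Proof.
move=> [[partQ _] [_ /(_ _ coherent_rel_config) coarse]] Re p q Rpq.
have /coarse ref : union_of_classes P (edge_set e).
  by apply: coherent_rel_union => -[x y] [x2 y2] /Re; rewrite !inE.
have [|X XQ sX] := ref [set q | R p q].
  by apply/imsetP; exists p => //; apply/setP=> r; rewrite !inE.
have /and3P[_ tiQ _] := partQ.
by rewrite !(def_pblock tiQ XQ) //; apply: (subsetP sX); rewrite inE.
Qed.

End CoherentRel.

(** The count is a sum of intersection numbers over the pairs of classes contained in [A] and
    [B]. *)
Lemma coherent_count (V : finType) (Q : {set {set V * V}}) (A B t : {set V * V}) a b a' b' :
  coherent_config Q -> union_of_classes Q A -> union_of_classes Q B ->
  t \in Q -> (a, b) \in t -> (a', b') \in t ->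
  #|[set g | ((a, g) \in A) && ((g, b) \in B)]| =
  #|[set g | ((a', g) \in A) && ((g, b') \in B)]|.
Proof.
move=> [partQ [_ [_ counts]]] unA unB tQ abt abt'.
have [covQ tiQ _] := and3P partQ; have cov p : p \in cover Q by rewrite (eqP covQ).
pose N a b (q : {set V * V} * {set V * V}) :=
  #|[set g | ((a, g) \in q.1) && ((g, b) \in q.2)]|.
pose PQ (q : {set V * V} * {set V * V}) :=
  [&& q.1 \in Q, q.2 \in Q, q.1 \subset A & q.2 \subset B].
have un X p : union_of_classes Q X -> (pblock Q p \subset X) = (p \in X).
  move=> unX; have pp : p \in pblock Q p by rewrite mem_pblock.
  apply/idP/idP => [/subsetP|pX]; first exact.
  have [//|dX] := unX _ (pblock_mem (cov p)).
  by rewrite (disjointFr dX pp) in pX.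
suff E x y : #|[set g | ((x, g) \in A) && ((g, y) \in B)]| = \sum_(q | PQ q) N x y q.
  rewrite !E; apply: eq_bigr => q /and4P[q1 q2 _ _].
  exact: (counts _ _ t).
rewrite -sum1_card (partition_big (fun g => (pblock Q (x, g), pblock Q (g, y))) PQ) /=.
  apply: eq_bigr => -[r s] /and4P[/= rQ sQ rA sB].
  rewrite /N -sum1_card; apply: eq_bigl => g; rewrite !inE xpair_eqE /=.
  have blockE X p : X \in Q -> (pblock Q p == X) = (p \in X).
    move=> XQ; apply/eqP/idP => [<-|]; first by rewrite mem_pblock.
    exact: def_pblock.
  rewrite !blockE //; apply: andb_idl => /andP[/(subsetP rA) -> /(subsetP sB) ->] //.
by move=> g; rewrite inE /PQ /= !pblock_mem //= !un.
Qed.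

Import GRing.Theory.
Local Open Scope ring_scope.

(** * Invariant functions and rigidity over a prime field *)

Section Coherence.
Variables (W : finType) (Rl : W -> W -> W -> W -> Prop).

(** [Rl] is first equality of difference colours on the cyclic group, and later the relation that
    game positions induce on residues modulo p. *)
Definition rinv T (F : W -> W -> T) : Prop :=
  forall x y x2 y2, Rl x y x2 y2 -> F x y = F x2 y2.

Definition rcoh : Prop := forall F G : W -> W -> bool, rinv F -> rinv G ->
  rinv (fun x y => #|[set w | F x w && G w y]|).

Lemma rinv_comp T U (h : T -> U) F : rinv F -> rinv (fun x y => h (F x y)).
Proof. by move=> iF x y x2 y2 xy; rewrite (iF _ _ _ _ xy). Qed.

Lemma rinv_comp2 T1 T2 U (h : T1 -> T2 -> U) F G : rinv F -> rinv G ->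
  rinv (fun x y => h (F x y) (G x y)).
Proof. by move=> iF iG x y x2 y2 xy; rewrite (iF _ _ _ _ xy) (iG _ _ _ _ xy). Qed.

Lemma eq_rinv T (F G : W -> W -> T) : (forall x y, F x y = G x y) -> rinv F -> rinv G.
Proof. by move=> FG iF x y x2 y2 xy; rewrite -!FG; apply: iF. Qed.

Hypothesis coh : rcoh.

(** Sorting [w] by the values [F x w] and [G w y] reduces ring-valued functions to their level sets,
    to which [coh] applies. *)
Lemma rinv_conv (R : finNzRingType) (F G : W -> W -> R) : rinv F -> rinv G ->
  rinv (fun x y => \sum_w F x w * G w y).
Proof.
move=> iF iG; pose N (p : R * R) x y := #|[set w | (F x w == p.1) && (G w y == p.2)]|.
suff E x y : \sum_w F x w * G w y = \sum_p (p.1 * p.2) *+ N p x y.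
  move=> x y x2 y2 xy; rewrite !E; apply: eq_bigr => p _; congr (_ *+ _).
  have iFp := rinv_comp (fun t => t == p.1) iF.
  have iGp := rinv_comp (fun t => t == p.2) iG.
  exact: (coh iFp iGp xy).
rewrite (partition_big (fun w => (F x w, G w y)) xpredT) //=.
apply: eq_bigr => -[s t] _; rewrite -sumr_const.
apply: eq_big => [w|w /eqP[-> ->]] //; by rewrite inE xpair_eqE.
Qed.

End Coherence.

(** * Circulant matrices modulo a prime, and multipliers *)

Section Frobenius.
Variables (n : nat) (Rl : 'I_n.+2 -> 'I_n.+2 -> 'I_n.+2 -> 'I_n.+2 -> Prop).
Hypothesis coh : rcoh Rl.
Variable q : nat.
Hypothesis q_pr : prime q.

(** The cyclic shift; circulant matrices are the polynomials in it. *)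
Let D := \matrix_(x < n.+2, y < n.+2) (x - y == 1)%:R : 'M['F_q]_n.+2.

Let DX k : D ^+ k = \matrix_(x, y) (x - y == k%:R)%:R.
Proof.
elim: k => [|k IH]; first by apply/matrixP=> x y; rewrite !mxE subr_eq0.
rewrite exprS IH; apply/matrixP=> x y; rewrite !mxE (bigD1 (x - 1)) //= big1 ?addr0.
  rewrite !mxE subKr eqxx mul1r; congr (_ %:R); rewrite -natr1 -subr_eq.
  by congr (nat_of_bool (_ == _)); ring.
move=> w neq; rewrite !mxE; case: eqP => [/esym e|]; last by rewrite mul0r.
by case/eqP: neq; rewrite e subKr.
Qed.

(* The Frobenius map on the commutative algebra of circulant matrices mod q; when q divides
   the order it counts the q-th roots of each element, otherwise it yields Schur's multipliers. *)
Lemma rinv_frobenius (X : {set 'I_n.+2}) : rinv Rl (fun x y => x - y \in X) ->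
  rinv Rl (fun x y => #|[set z in X | z *+ q == x - y]|%:R : 'F_q).
Proof.
move=> iX; pose M := \matrix_(x, y) (x - y \in X)%:R : 'M['F_q]_n.+2.
have inv_pow k : rinv Rl (fun x y => (M ^+ k.+1) x y).
  have iM : rinv Rl (fun x y => M x y).
    apply: (eq_rinv _ (rinv_comp (fun b : bool => b%:R : 'F_q) iX)) => x y.
    by rewrite mxE.
  elim: k => [|k IH]; first exact: iM.
  apply: (eq_rinv _ (rinv_conv coh iM IH)) => x y.
  by rewrite [M ^+ k.+2]exprS mxE.
have Fq : q \in [pchar {poly 'F_q}] by rewrite pchar_poly pchar_Fp.
have M_poly : M = horner_mx D (\sum_(z in X) 'X^(nat_of_ord z)).
  rewrite rmorph_sum; apply/matrixP=> x y; rewrite summxE mxE.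
  under eq_bigr do rewrite rmorphXn /= horner_mx_X DX mxE natr_Zp mulrb.
  rewrite -big_mkcondr /=.
  case: (boolP (x - y \in X)) => [xyX|xyX].
    rewrite (bigD1 (x - y)) ?xyX ?eqxx //= big1 ?addr0 // => z.
    by case/andP=> /andP[_ /eqP->]; rewrite eqxx.
  by rewrite big1 // => z /andP[zX /eqP e]; rewrite e zX in xyX.
have M_q : M ^+ q = \sum_(z in X) D ^+ (z * q).
  rewrite M_poly -rmorphXn /=.
  have -> P : P ^+ q = pFrobenius_aut Fq P by [].
  rewrite !rmorph_sum /=; apply: eq_bigr => z _.
  by rewrite pFrobenius_autE -exprM rmorphXn /= horner_mx_X.
have inv_q k : (0 < k)%N -> rinv Rl (fun x y => (M ^+ k) x y).
  by case: k => // k _; apply: inv_pow.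
apply: (eq_rinv _ (inv_q q (prime_gt0 q_pr))) => x y.
rewrite M_q summxE; under eq_bigr do rewrite DX mxE natrM natr_Zp mulr_natr eq_sym mulrb.
rewrite -big_mkcondr /= sumr_const -sum1_card; congr (_%:R).
rewrite -sum1_card; apply: eq_bigl => z; rewrite inE.
by [].
Qed.

Lemma Zp_mulrn_inj k : coprime k n.+2 -> injective (fun z : 'I_n.+2 => z *+ k).
Proof.
move=> co z z2 /=; rewrite -[z *+ k]mulr_natr -[z2 *+ k]mulr_natr.
by apply: mulIr; have := @unitZpE n.+2 k isT; rewrite coprime_sym co.
Qed.
End Frobenius.

(** Schur's theorem on multipliers, one prime factor of [k] at a time: multiplication by a prime
    coprime to the order is injective, so the Frobenius count is 0 or 1 and is the indicator of the
    image of [X]. *)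
Lemma rinv_multiplier n (Rl : 'I_n.+2 -> 'I_n.+2 -> 'I_n.+2 -> 'I_n.+2 -> Prop)
    (coh : rcoh Rl) (X : {set 'I_n.+2}) k :
  coprime k n.+2 -> rinv Rl (fun x y => x - y \in X) ->
  rinv Rl (fun x y => x - y \in [set z *+ k | z in X]).
Proof.
elim/ltn_ind: k => k IH in X *; have [-> _|k1] := eqVneq k 1%N.
  by rewrite imset_id.
have [->|k0] := posnP k; first by rewrite /coprime gcd0n.
have pr_q : prime (pdiv k) by rewrite pdiv_prime // ltn_neqAle eq_sym k1.
rewrite -(divnK (pdiv_dvd k)) coprimeMl => /andP[co_m co_q] iX.
have iqX : rinv Rl (fun x y => x - y \in [set z *+ pdiv k | z in X]).
  apply: (eq_rinv _ (rinv_comp (fun t => t != 0) (rinv_frobenius coh pr_q iX))) => x y.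
  case: imsetP => [[z zX xyE]|noz].
    rewrite (_ : [set _ in _ | _] = [set z]) ?cards1 ?oner_neq0 //.
    apply/setP=> u; rewrite !inE xyE (inj_eq (Zp_mulrn_inj co_q)).
    by case: eqP => [->|]; rewrite ?zX ?andbF.
  rewrite eq_card0 ?eqxx // => z; rewrite inE.
  by apply/andP=> -[zX /eqP e]; case: noz; exists z.
have lt_m : (k %/ pdiv k < k)%N by rewrite ltn_Pdiv ?prime_gt1.
apply: (eq_rinv _ (IH _ lt_m _ co_m iqX)) => x y; rewrite -imset_comp.
suff -> : [set ((fun z => z *+ (k %/ pdiv k)) \o (fun z => z *+ pdiv k)) z | z in X]
  = [set z *+ (k %/ pdiv k * pdiv k) | z in X] by [].
by apply: eq_imset => z /=; rewrite -mulrnA mulnC.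
Qed.

Lemma expf_neq1_ex (F : finFieldType) k : (0 < k < #|F|.-1)%N ->
  exists2 c : F, c != 0 & c ^+ k != 1.
Proof.
case/andP=> k0 ltk; apply/exists_inP; apply: contraLR ltk => /exists_inPn roots1.
rewrite -leqNgt -(cardC1 (0 : F)) cardE; apply: max_unity_roots => //.
  apply/allP=> c; rewrite mem_enum => c0; apply/unity_rootP/eqP.
  by have := roots1 c c0; rewrite negbK.
exact: enum_uniq.
Qed.

(** * Slopes over a prime field *)

Section PrimeField.
Variable p : nat.
Hypothesis p_pr : prime p.

Lemma ndvd_fact i : (i < p)%N -> ~~ (p %| i`!)%N.
Proof.
elim: i => [|i IH] lt_ip; first by rewrite dvdn1 gtn_eqF ?prime_gt1.
by rewrite factS Euclid_dvdM // negb_or IH ?gtnNdvd // ltnW.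
Qed.

Local Notation F := 'F_p.

Lemma coprimeFp k : (0 < k < (Zp_trunc (pdiv p)).+2)%N -> coprime k (Zp_trunc (pdiv p)).+2.
Proof.
by rewrite Fp_cast // => /andP[k0 ltk]; rewrite coprime_sym prime_coprime // gtnNdvd.
Qed.

(** Orthogonality of the characters of the multiplicative group: the bounds keep distinct [i] and
    [j] distinct modulo p - 1, and the group order p - 1 is -1 in the field. *)
Lemma sum_expf i j : (i < p.-1)%N -> (j < p.-1)%N ->
  \sum_(z : F | z != 0) z ^+ i / z ^+ j = - (i == j)%:R.
Proof.
(* Replacing [z] by [c * z] multiplies the sum by [c ^+ k], which differs from 1 for a suitable
   [c]. *)
have sum0 k : (0 < k < p.-1)%N -> \sum_(z : F | z != 0) z ^+ k = 0.
  rewrite -{1}(card_Fp p_pr) => /expf_neq1_ex[c c0 ck1].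
  set s := \sum_(z | _) _; suff: (c ^+ k - 1) * s = 0.
    by move/eqP; rewrite mulf_eq0 subr_eq0 (negbTE ck1) => /eqP.
  rewrite mulrBl mul1r; apply/eqP; rewrite subr_eq0 mulr_sumr eq_sym; apply/eqP.
  rewrite /s (reindex_inj (mulfI c0)) /=; apply: eq_big => z.
    by rewrite mulf_eq0 (negbTE c0).
  by rewrite exprMn.
have exp_inv (z : F) k : (k < p.-1)%N -> z != 0 -> (z ^+ k)^-1 = z ^+ (p.-1 - k).
  move=> ltk z0; apply: (mulfI (expf_neq0 k z0)); rewrite divff ?expf_neq0 //.
  rewrite -exprD subnKC 1?ltnW //; apply: (mulfI z0).
  rewrite -exprS prednK ?prime_gt0 // mulr1.
  by have := expf_card z; rewrite card_Fp.
move=> lti ltj; have [-> |neq_ij] := eqVneq i j.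
  under eq_bigr => z z0 do rewrite divff ?expf_neq0 //.
  rewrite sumr_const cardC1 card_Fp //; apply/eqP; rewrite -addr_eq0 natr1.
  by rewrite prednK ?prime_gt0 // pcharf0 // pchar_Fp.
rewrite oppr0; have [lt_ij|le_ji] := ltnP i j.
  under eq_bigr => z z0 do rewrite exp_inv // -exprD.
  by apply: sum0; lia.
have lt_ji : (j < i)%N by rewrite ltn_neqAle eq_sym neq_ij.
under eq_bigr => z z0 do rewrite -{1}(subnK le_ji) exprD mulfK ?expf_neq0 //.
by apply: sum0; lia.
Qed.

Variable Rl : F -> F -> F -> F -> Prop.
Hypothesis coh : rcoh Rl.
Hypothesis inv0 : rinv Rl (fun x _ => x == 0).
Hypothesis inv_eq : rinv Rl (fun x y => x == y).

(** Convolution passes through a middle point [w] with [w = 0] and [w = y], which moves the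
    condition to the second coordinate. *)
Let inv0r : rinv Rl (fun _ y => y == 0).
Proof.
have iG : rinv Rl (fun x y => (x == 0) && (x == y)) by apply: rinv_comp2.
have iT : rinv Rl (fun _ _ => true) by [].
apply: (eq_rinv _ (rinv_comp (fun k => 0 < k)%N (coh iT iG))) => x y /=.
apply/card_gt0P/eqP => [[w]|->]; last by exists 0; rewrite inE !eqxx.
by rewrite inE => /andP[/eqP-> /eqP->].
Qed.

Section Power.
Variable d : nat.
Hypothesis d0 : (0 < d)%N.
Hypothesis d_lt : (d < p.-1)%N.
Hypothesis inv_d : rinv Rl (fun x y => (x - y) ^+ d).

(** Extending by 0 to the axes makes convolution over F_p a convolution over its multiplicative
    group. *)
Let slope_poly (f : nat -> F) x y : F :=
  if (x == 0) || (y == 0) then 0 else \sum_(i < d.+1) f i * (y / x) ^+ i.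

Let slope_poly_conv f g x y :
  \sum_z slope_poly f x z * slope_poly g z y =
  - slope_poly (fun i => f i * g i) x y.
Proof.
rewrite /slope_poly; have [->|x0] /= := eqVneq x 0.
  by rewrite oppr0 big1 // => z _; rewrite mul0r.
have [->|y0] /= := eqVneq y 0.
  by rewrite oppr0 big1 // => z _; rewrite orbT mulr0.
rewrite (bigID (fun z => z == 0)) /= big1 ?add0r; last by move=> z ->; rewrite mul0r.
have term z : z != 0 ->
    (if (z == 0) then 0 else \sum_(i < d.+1) f i * (z / x) ^+ i) *
    (if (z == 0) || false then 0 else \sum_(i < d.+1) g i * (y / z) ^+ i) =
    \sum_(i < d.+1) \sum_(j < d.+1) f i * g j / x ^+ i * y ^+ j * (z ^+ i / z ^+ j).
  move=> z0; rewrite (negbTE z0) /= mulr_suml; apply: eq_bigr => i _.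
  rewrite mulr_sumr; apply: eq_bigr => j _; rewrite !expr_div_n.
  by ring.
under eq_bigr => z z0 do rewrite term //.
rewrite exchange_big -sumrN /=; apply: eq_bigr => i _.
rewrite exchange_big (bigD1 i) //= [X in _ + X]big1 ?addr0 => [|j neq_ji].
  rewrite -mulr_sumr sum_expf ?eqxx ?(leq_trans (ltn_ord _)) //.
  by rewrite mulrN mulr1 expr_div_n; congr (- _); rewrite -!mulrA; congr (_ * (_ * _)); rewrite mulrC.
rewrite -mulr_sumr sum_expf ?(leq_trans (ltn_ord _)) //.
by rewrite eq_sym (_ : (_ == _) = false) ?oppr0 ?mulr0 //; apply/negbTE; rewrite -val_eqE in neq_ji.
Qed.

Let inv_conv f g : rinv Rl (slope_poly f) -> rinv Rl (slope_poly g) ->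
  rinv Rl (slope_poly (fun i => f i * g i)).
Proof.
move=> iF iG; apply: (eq_rinv _ (rinv_comp (fun t => - t) (rinv_conv coh iF iG))) => x y.
by rewrite slope_poly_conv opprK.
Qed.

(** Convolution with the indicator of 0 specialises the second point of (x - y)^d to 0. *)
Let inv_xd : rinv Rl (fun x _ => x ^+ d).
Proof.
have iG := rinv_comp (fun b : bool => b%:R : F) inv0.
apply: (eq_rinv _ (rinv_conv coh inv_d iG)) => x y.
rewrite (bigD1 0) // eqxx mulr1 subr0 big1 => [|z /negbTE ->]; last by rewrite mulr0.
exact: addr0.
Qed.

Let inv_yd : rinv Rl (fun _ y => y ^+ d).
Proof.
have iG := rinv_comp (fun b : bool => b%:R : F) inv0r.
have iC := rinv_comp (fun t => (-1) ^+ d * t) (rinv_conv coh iG inv_d).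
apply: (eq_rinv _ iC) => x y.
rewrite (bigD1 0) // eqxx mul1r sub0r big1 => [|z /negbTE ->]; last by rewrite mul0r.
by rewrite [X in _ * X](addr0 _) -exprMn mulN1r opprK.
Qed.

(* The coefficients of (1 - t)^d are nonzero mod p, so their (p-1)-st powers are all 1. *)
Let inv_geometric : rinv Rl (slope_poly (fun _ => 1)).
Proof.
(* The coefficients of (1 - t)^d, which is (x - y)^d / x^d for t = y / x. *)
pose c i : F := (-1) ^+ i *+ 'C(d, i).
have inv_c : rinv Rl (slope_poly c).
  have iU := rinv_comp2 (fun s t : F => s / t) inv_d inv_xd.
  have iZ := rinv_comp2 orb inv0 inv0r.
  apply: (eq_rinv _ (rinv_comp2 (fun (b : bool) t => if b then 0 else t) iZ iU)) => x y.
  rewrite /slope_poly; case: ifP => // /norP[x0 y0].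
  rewrite -expr_div_n mulrBl divff // exprBn; apply: eq_bigr => i _.
  by rewrite expr1n mulr1 /c mulrnAl.
have inv_pow k : rinv Rl (slope_poly (fun i => c i ^+ k.+1)).
  elim: k => [|k IH]; first exact: inv_c.
  by apply: (eq_rinv _ (inv_conv inv_c IH)) => x y; rewrite /slope_poly;
    case: ifP => // _; apply: eq_bigr => i _; rewrite [c i ^+ k.+2]exprS.
have p2 : (0 < p.-1)%N by apply: leq_ltn_trans d_lt.
apply: (eq_rinv _ (inv_pow p.-2)) => x y; rewrite /slope_poly; case: ifP => // _.
apply: eq_bigr => i _; congr (_ * _); rewrite prednK //.
have c0 : c i != 0.
  rewrite /c -mulr_natr mulf_neq0 ?signr_eq0 // -(dvdn_pcharf (pchar_Fp p_pr)).
  have lt_dp : (d < p)%N by lia.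
  apply: contra (ndvd_fact lt_dp) => /dvdn_mulr.
  by move/(_ (i`! * (d - i)`!)%N); rewrite bin_fact // -ltnS.
apply: (mulfI c0); rewrite -exprS prednK ?prime_gt0 // mulr1.
by have := expf_card (c i); rewrite card_Fp.
Qed.

(** With h = 1 + t + ... + t^d and s = 1 + t + ... + t^(d-1) one has h - 1 = t s and h - t^d = s, so
    t is a quotient of invariants; s = 0 would force t^d = 1. *)
Let inv_slope_generic :
  rinv Rl (fun x y => if [&& x != 0, y != 0 & (y / x) ^+ d != 1] then y / x else 0).
Proof.
have iT : rinv Rl (fun x y => y ^+ d / x ^+ d) := rinv_comp2 (fun s t : F => s / t) inv_yd inv_xd.
have iQ := rinv_comp2 (fun h t => if t == 1 then 0 else (h - 1) / (h - t)) inv_geometric iT.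
have iZ := rinv_comp2 orb inv0 inv0r.
apply: (eq_rinv _ (rinv_comp2 (fun (b : bool) t => if b then 0 else t) iZ iQ)) => x y.
rewrite /slope_poly; case: ifP => [/orP[]->|]; rewrite ?andbF //.
move/norP=> [x0 y0]; rewrite x0 y0 -expr_div_n /=; set t := y / x.
case: eqP => //= td1; under eq_bigr do rewrite mul1r.
have sumE : \sum_(i < d.+1) t ^+ i = \sum_(i < d) t ^+ i + t ^+ d by rewrite big_ord_recr.
have sumE1 : \sum_(i < d.+1) t ^+ i = 1 + t * \sum_(i < d) t ^+ i.
  by rewrite big_ord_recl mulr_sumr; congr (_ + _); apply: eq_bigr => i _; rewrite -exprS.
rewrite (negbTE x0) (negbTE y0) /= {1}sumE1 sumE addrK addrC addKr mulfK //.
apply/eqP=> s0; case: td1; apply/eqP; rewrite -subr_eq0 subrX1.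
by rewrite s0 mulr0.
Qed.

Let inv_slope_val t : t != 0 -> rinv Rl (fun x y => (x != 0) && (y == t * x)).
Proof.
have gen u : u != 0 -> u ^+ d != 1 -> rinv Rl (fun x y => (x != 0) && (y == u * x)).
  move=> u0 ud; apply: (eq_rinv _ (rinv_comp (fun s => s == u) inv_slope_generic)) => x y.
  have [->|x0] /= := eqVneq x 0; first by rewrite eq_sym (negbTE u0).
  apply/eqP/eqP => [|->].
    by case: ifP => [_ <-|_ /esym/eqP]; rewrite ?divfK // (negbTE u0).
  by rewrite mulf_neq0 // mulfK // ud.
move=> t0; have [td|] := eqVneq (t ^+ d) 1; last exact: gen.
have [c c0 cd] : exists2 c : F, c != 0 & c ^+ d != 1.
  by apply: expf_neq1_ex; rewrite d0 card_Fp.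
have tc0 : t / c != 0 by rewrite mulf_neq0 ?invr_neq0.
have tcd : (t / c) ^+ d != 1 by rewrite expr_div_n td div1r invr_eq1.
apply: (eq_rinv _ (rinv_comp (fun k => 0 < k)%N (coh (gen _ c0 cd) (gen _ tc0 tcd)))) => x y.
apply/card_gt0P/andP => [[w]|[x0 /eqP->]].
  rewrite inE => /andP[/andP[x0 /eqP->] /andP[_ /eqP->]]; split=> //.
  by rewrite mulrA divfK.
by exists (c * x); rewrite inE x0 mulf_neq0 // mulrA divfK // !eqxx.
Qed.

Lemma slope_of_power x y x2 y2 : Rl x y x2 y2 -> x != 0 -> x2 != 0 /\ y2 / x2 = y / x.
Proof.
move=> xy x0; have x20 : x2 != 0 by rewrite -(inv0 xy).
split=> //; have [y0|y0] := eqVneq y 0.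
  have /esym/eqP -> : true = (y2 == 0) by rewrite -(inv0r xy) y0 eqxx.
  by rewrite y0 !mul0r.
have yx0 : y / x != 0 by rewrite mulf_neq0 ?invr_neq0.
have := inv_slope_val yx0 xy; rewrite x0 divfK // eqxx => /esym/andP[_ /eqP->].
by rewrite mulfK.
Qed.

End Power.

(* The multipliers of S form a subgroup K of F_p^*, and all the sets v S are invariant,
   so the coset x K, hence the power x^|K|, is an invariant of the difference x. *)
Theorem slope_rigidity (S : {set F}) s r : rinv Rl (fun x y => x - y \in S) ->
  s \in S -> s != 0 -> r \notin S -> r != 0 ->
  forall x y x2 y2, Rl x y x2 y2 -> x != 0 -> x2 != 0 /\ y2 / x2 = y / x.
Proof.
move=> iS sS s0 rS r0.
pose K : {set F} := [set k | (k != 0) && [forall u, (u \in S) == (k * u \in S)]].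
have K1 : 1 \in K.
  by rewrite inE oner_neq0; apply/forallP=> u; rewrite mul1r.
have K0 k : k \in K -> k != 0 by rewrite inE => /andP[].
have KS k u : k \in K -> (k * u \in S) = (u \in S).
  by rewrite inE => /andP[_ /forallP/(_ u)/eqP].
have KM k l : k \in K -> (k * l \in K) = (l \in K).
  move=> kK; rewrite !inE mulf_eq0 (negbTE (K0 _ kK)) /=; congr (_ && _).
  by apply: eq_forallb => u; rewrite -mulrA KS.
have Kd k : k \in K -> k ^+ #|K| = 1.
  move=> kK; have k0 := K0 k kK; pose P := \prod_(x in K) x.
  have P0 : P != 0 by apply/prodf_neq0 => i /K0.
  apply: (mulIf P0); rewrite mul1r {2}/P (reindex_inj (mulfI k0)) /=.
  rewrite (eq_bigl (fun x => x \in K)) => [|x]; last exact: KM.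
  by rewrite big_split /= prodr_const.
have d_gt0 : (0 < #|K|)%N by apply/card_gt0P; exists 1.
(* Here the second colour enters: [r / s] is not a multiplier of [S]. *)
have d_lt : (#|K| < p.-1)%N.
  suff: (#|K| < #|predC1 (0%R : F)|)%N by rewrite cardC1 card_Fp.
  apply/proper_card/properP; split.
    by apply/subsetP=> k /K0; rewrite !inE.
  exists (r / s); first by rewrite !inE mulf_neq0 ?invr_neq0.
  by apply: contra rS => /(KS _ s); rewrite sS divfK // => ->.
apply: (slope_of_power d_gt0 d_lt) => x y x2 y2 xy.
have [eq_xy|neq_xy] := eqVneq x y.
  have := inv_eq xy; rewrite eq_xy eqxx => /esym/eqP ->.
  by rewrite !subrr.
have xy0 : x - y != 0 by rewrite subr_eq0.
have xy20 : x2 - y2 != 0 by rewrite subr_eq0 -(inv_eq xy).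
have kK : (x2 - y2) / (x - y) \in K; last first.
  have := Kd _ kK; rewrite expr_div_n => /(congr1 (fun t => t * (x - y) ^+ #|K|)).
  by rewrite divfK ?expf_neq0 // mul1r.
rewrite inE mulf_neq0 ?invr_neq0 //=; apply/forallP=> u; apply/eqP.
have [->|u0] := eqVneq u 0; first by rewrite mulr0.
have mulS v z : v != 0 -> (v * z \in [set a *+ nat_of_ord v | a in S]) = (z \in S).
  move=> v0; have E a : a *+ nat_of_ord v = v * a by rewrite -mulr_natl natr_Zp.
  apply/imsetP/idP => [[a aS]|zS]; last by exists z.
  by rewrite E => /(mulfI v0) ->.
(* Since x - y = v u, invariance of the scaled set v S says that [u] and its multiple by the
   quotient of the differences lie in [S] simultaneously. *)
pose v := (x - y) / u; have v0 : v != 0 by rewrite mulf_neq0 ?invr_neq0.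
have co : coprime (nat_of_ord v) (Zp_trunc (pdiv p)).+2.
  apply: coprimeFp; rewrite ltn_ord andbT lt0n; apply: contra v0 => /eqP v00.
  exact/eqP/val_inj.
have E1 : x - y = v * u by rewrite /v divfK.
have E2 : x2 - y2 = v * ((x2 - y2) / (x - y) * u) by rewrite /v; field; rewrite ?xy0 ?u0.
have inv_v := rinv_multiplier coh co iS.
rewrite -(mulS v u v0) -E1 -(mulS v _ v0) -E2.
exact: inv_v xy.
Qed.

End PrimeField.

(** * Schur colourings of rank four *)

Section Zp.
Variable n : nat.
Local Notation V := 'I_n.+2.

Lemma natr_Zp_eq0 k : (k%:R == 0 :> V) = (n.+2 %| k)%N.
Proof. by rewrite -val_eqE /= Zp_nat. Qed.

Lemma mulrn_Zp_eq0 (z : V) k : (z *+ k == 0) = (n.+2 %| z * k)%N.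
Proof. by rewrite -natr_Zp_eq0 natrM natr_Zp mulr_natr. Qed.

Lemma card_multiples d : (d %| n.+2)%N -> #|[set z : V | (d %| z)%N]| = (n.+2 %/ d)%N.
Proof.
move=> dN; have d0 : (0 < d)%N by rewrite (dvdn_gt0 _ dN).
have lt_dN (i : 'I_(n.+2 %/ d)) : (i * d < n.+2)%N.
  by rewrite -[X in (_ < X)%N](divnK dN) ltn_mul2r d0 ltn_ord.
rewrite -[RHS]card_ord -(card_imset (f := fun i => Ordinal (lt_dN i))); last first.
  by move=> i j /(congr1 val)/eqP /=; rewrite eqn_pmul2r // => /eqP/val_inj.
apply: eq_card => z; rewrite inE; apply/idP/imsetP => [dz|[i _ ->]]; last exact: dvdn_mull.
have lt_zd : (z %/ d < n.+2 %/ d)%N by rewrite ltn_divLR // divnK.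
by exists (Ordinal lt_zd) => //; apply: val_inj; rewrite /= divnK.
Qed.

Lemma card_torsion k : (k %| n.+2)%N -> #|[set z : V | z *+ k == 0]| = k.
Proof.
move=> kN; have k0 : (0 < k)%N by rewrite (dvdn_gt0 _ kN).
have e : [set z : V | z *+ k == 0] = [set z : V | (n.+2 %/ k %| z)%N].
  by apply/setP=> z; rewrite !inE mulrn_Zp_eq0 -{1}(divnK kN) dvdn_pmul2r.
have dN : (n.+2 %/ k %| n.+2)%N by rewrite -{2}(divnK kN) dvdn_mulr.
by rewrite e (card_multiples dN) divnA // mulKn.
Qed.

Lemma zmod_add (H : {set V}) x y : zmod_closed H -> x \in H -> (x + y \in H) = (y \in H).
Proof.
move=> [H0 HB] xH; apply/idP/idP => h; last first.
  have yN : - y \in H by rewrite -sub0r; apply: HB.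
  by rewrite -[y]opprK; apply: HB.
by have := HB _ _ h xH; rewrite [x + y]addrC addrK.
Qed.

Lemma zmod_opp (H : {set V}) x : zmod_closed H -> (- x \in H) = (x \in H).
Proof.
move=> [H0 HB]; apply/idP/idP => h; last by rewrite -sub0r; apply: HB.
by rewrite -[x]opprK -sub0r; apply: HB.
Qed.

Lemma zmod_closed_multiples (H : {set V}) : zmod_closed H ->
  exists d, [/\ (0 < d)%N, (d %| n.+2)%N & forall z, (z \in H) = (d %| z)%N].
Proof.
move=> HP; have [H0 HB] := HP.
have HM (z : V) k : z \in H -> z *+ k \in H.
  by move=> zH; elim: k => [|k IH]; rewrite ?mulr0n // mulrS (zmod_add _ HP).
(* The modulus itself represents 0, so the search succeeds even for the zero subgroup. *)
have ex_d : exists k, (0 < k)%N && ((k%:R : V) \in H).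
  by exists n.+2; rewrite /= (eqP (_ : n.+2%:R == 0)) // natr_Zp_eq0.
pose d := ex_minn ex_d; have [d0 dH d_min] : [/\ (0 < d)%N, (d%:R : V) \in H
    & forall k, (0 < k)%N -> (k%:R : V) \in H -> (d <= k)%N].
  by rewrite /d; case: ex_minnP => k /andP[k0 kH] min; split=> // l l0 lH; apply: min; rewrite l0.
have dE k : ((k%:R : V) \in H) = (d %| k)%N.
  apply/idP/dvdnP=> [|[j ->]]; last by rewrite mulnC natrM mulr_natr HM.
  rewrite {1}(divn_eq k d) natrD (zmod_add _ HP); last by rewrite mulnC natrM mulr_natr HM.
  move=> rH; exists (k %/ d)%N; rewrite [LHS](divn_eq k d).
  have [->|r0] := posnP (k %% d)%N; first by rewrite addn0.
  by have := d_min _ r0 rH; rewrite leqNgt ltn_mod d0.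
exists d; split=> // [|z]; last by rewrite -dE natr_Zp.
by rewrite -dE (eqP (_ : n.+2%:R == 0)) // natr_Zp_eq0.
Qed.
End Zp.

(** * Invariant subgroups of Schur rings over cyclic groups *)

Section SchurColoring.
Variables (n : nat) (T : eqType).
Local Notation V := 'I_n.+2.
Implicit Types (c : V -> T) (X Y H : {set V}).

Definition aset c X : Prop := forall z z2, c z = c z2 -> (z \in X) = (z2 \in X).

Definition conv X Y z : nat := #|[set w | (w \in X) && (z - w \in Y)]|.

(* The fibres of c are the basic sets of a symmetric Schur ring over Z_(n+2). *)
Definition schur_coloring c : Prop :=
  [/\ forall z, c (- z) = c z, forall z, c z = c 0 -> z = 0
    & forall X Y, aset c X -> aset c Y -> forall z z2, c z = c z2 ->
      conv X Y z = conv X Y z2].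

Variable c : V -> T.
Hypothesis cP : schur_coloring c.

Let Rc x y x2 y2 := c (x - y) = c (x2 - y2).

Lemma aset_rinv X : aset c X -> rinv Rc (fun x y => x - y \in X).
Proof. by move=> aX x y x2 y2; apply: aX. Qed.

Lemma rinv_aset (F : V -> V -> bool) : rinv Rc F -> aset c [set z | F z 0].
Proof. by move=> iF z z2 zz2; rewrite !inE; apply: iF; rewrite /Rc !subr0. Qed.

Lemma schur_rcoh : rcoh Rc.
Proof.
case: cP => _ _ coh F G iF iG x y x2 y2 xy.
have trans (K : V -> V -> bool) u v : rinv Rc K -> K u v = K (u - v) 0.
  by move=> iK; apply: iK; rewrite /Rc subr0.
have E u v : #|[set w | F u w && G w v]| =
    conv [set z | F z 0] [set z | G z 0] (u - v).
  rewrite /conv -(card_preimset _ (@subrI _ u)); apply: eq_card => w.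
  rewrite !inE (trans F) // (trans G) //; congr (F _ _ && G _ _); ring.
by rewrite !E; apply: coh xy; apply: rinv_aset.
Qed.

Lemma aset_opp X z : aset c X -> (- z \in X) = (z \in X).
Proof. by case: cP => cN _ _ aX; apply: aX. Qed.

Lemma aset0 : aset c [set 0].
Proof.
case: cP => _ c0 _ z z2 zz2; rewrite !inE.
by apply/eqP/eqP => z0; apply: c0; [rewrite -zz2 z0|rewrite zz2 z0].
Qed.

Lemma asetT : aset c [set: V]. Proof. by move=> z z2 _; rewrite !inE. Qed.

Definition basic x : {set V} := [set z | c z == c x].

Lemma aset_basic x : aset c (basic x).
Proof. by move=> z z2 zz2; rewrite !inE zz2. Qed.

Lemma basic_id x : x \in basic x. Proof. by rewrite inE. Qed.

Lemma conv_aset X Y z z2 : aset c X -> aset c Y -> c z = c z2 ->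
  conv X Y z = conv X Y z2.
Proof. by case: cP => _ _ coh aX aY; apply: coh. Qed.

(** The autocorrelation of [X]; it equals #|X| exactly at the periods of [X]. *)
Definition corr X u : nat := #|[set v | (v \in X) && (v + u \in X)]|.

Lemma corr_aset X u u2 : aset c X -> c u = c u2 -> corr X u = corr X u2.
Proof.
move=> aX uu2; suff E v : corr X v = conv X X v by rewrite !E; apply: conv_aset.
rewrite /conv -(card_preimset _ (@oppr_inj V)); apply: eq_card => w.
by rewrite !inE aset_opp // opprK addrC.
Qed.

Lemma corr0 X : corr X 0 = #|X|.
Proof. by apply: eq_card => v; rewrite !inE addr0 andbb. Qed.

Lemma corr_full X u : corr X u = #|X| -> forall v, v \in X -> v + u \in X.
Proof.
move=> e v vX; have /setP/(_ v) : [set v | (v \in X) && (v + u \in X)] = X.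
  apply/eqP; rewrite eqEcard -[#|X|]e leqnn andbT.
  by apply/subsetP=> w; rewrite inE => /andP[].
by rewrite inE vX /= => ->.
Qed.

Lemma sum_corr X Y : (\sum_(u in Y) corr X u = \sum_(v in X) #|[set u in Y | (v + u)%R \in X]|)%N.
Proof.
rewrite /corr; under eq_bigr do rewrite -sum1_card.
rewrite (exchange_big_dep (fun v => v \in X)) /=; last first.
  by move=> u v _; rewrite inE => /andP[].
apply: eq_bigr => v vX; rewrite -sum1_card; apply: eq_bigl => u.
by rewrite !inE vX.
Qed.

Definition asubgroup H : Prop := zmod_closed H /\ aset c H.

Definition stab X : {set V} := [set u | [forall v, (v + u \in X) == (v \in X)]].

(** The group of periods, the radical of X, is a level set of the autocorrelation, which is constant
    on colours. *)
Lemma asubgroup_stab X : aset c X -> asubgroup (stab X).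
Proof.
move=> aX; have stabE u : (u \in stab X) = (corr X u == #|X|).
  rewrite inE; apply/forallP/eqP => [h|/corr_full h v].
    by apply: eq_card => v; rewrite inE (eqP (h v)) andbb.
  have inj : [set v + u | v in X] = X.
    apply/eqP; rewrite eqEcard card_imset ?leqnn ?andbT; last exact: addIr.
    by apply/subsetP=> _ /imsetP[w wX ->]; apply: h.
  by rewrite -{1}inj; apply/eqP/(mem_imset _ _ (@addIr _ u)).
split; last by move=> u u2 uu2; rewrite !stabE (corr_aset aX uu2).
split; first by rewrite inE; apply/forallP=> v; rewrite addr0.
move=> u w; rewrite !inE => /forallP hu /forallP hw; apply/forallP=> v.
by rewrite -(eqP (hw (v + (u - w)))) -addrA subrK hu.
Qed.

Let sumset (Z : {set V}) k : {set V} :=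
  iter k (fun S : {set V} => [set x | [exists w in S, x - w \in Z]]) [set 0].

(** The generated subgroup is the union of the iterated sumsets of [Z]. Each is the support of a
    convolution, hence invariant, and symmetry of the colouring gives closure under negation. *)
Lemma asubgroup_gen (Z K : {set V}) : aset c Z -> zmod_closed K -> Z \subset K ->
  exists2 W, asubgroup W & (Z \subset W) && (W \subset K).
Proof.
move=> aZ KP sZK; have [K0 _] := KP.
have aS k : aset c (sumset Z k).
  elim: k => [|k IH]; first exact: aset0.
  suff -> : sumset Z k.+1 = [set x | (0 < conv (sumset Z k) Z x)%N].
    by move=> z z2 zz2; rewrite !inE (conv_aset IH aZ zz2).
  apply/setP=> x; rewrite !inE; apply/existsP/card_gt0P => -[w h];
    by exists w; rewrite inE in h *.
have SK k : sumset Z k \subset K.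
  elim: k => [|k IH]; first by rewrite sub1set.
  apply/subsetP=> x; rewrite inE => /exists_inP[w wS /(subsetP sZK) xw].
  by rewrite -[x](subrKC w) (zmod_add _ KP) // (subsetP IH).
have SD k l x y : x \in sumset Z k -> y \in sumset Z l -> x + y \in sumset Z (l + k).
  move=> xS; elim: l y => [|l IH] y; first by rewrite inE => /eqP->; rewrite addr0.
  rewrite inE => /exists_inP[w /IH wS yw]; rewrite inE.
  by apply/exists_inP; exists (x + w) => //; rewrite opprD addrACA subrr add0r.
have SN k x : x \in sumset Z k -> - x \in sumset Z k by rewrite aset_opp.
pose W := [set x | `[< exists k, x \in sumset Z k >]].
exists W; last first.
  apply/andP; split; apply/subsetP=> x; last first.
    by rewrite inE => /asboolP[k] /(subsetP (SK k)).
  move=> xZ; rewrite inE; apply/asboolP; exists 1%N; rewrite inE.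
  by apply/exists_inP; exists 0; rewrite ?inE ?subr0.
split; last first.
  by move=> z z2 zz2; rewrite !inE; apply: asbool_equiv_eq; split=> -[k];
    exists k; [rewrite -(aS k _ _ zz2)|rewrite (aS k _ _ zz2)].
split; first by rewrite inE; apply/asboolP; exists 0%N; rewrite inE.
move=> x y; rewrite !inE => /asboolP[k xk] /asboolP[l /SN yl]; apply/asboolP.
by exists (l + k)%N; apply: SD.
Qed.

(* Modulo p, the number of points of X over a non-invariant point of p G vanishes, so X meets the
   corresponding coset of the p-torsion in 0 or p points. *)
Lemma torsion_coset p X H : prime p -> (p %| n.+2)%N -> aset c X ->
  (forall W, asubgroup W -> W != setT -> W \subset H) ->
  forall w u, w \in X -> w *+ p \notin H -> u *+ p = 0 -> w + u \in X.
Proof.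
move=> p_pr p_dvd aX subH w u wX wpH up0.
pose Z := [set z | #|[set x in X | x *+ p == z]|%:R != 0 :> 'F_p].
have aZ : aset c Z.
  have := rinv_frobenius schur_rcoh p_pr (aset_rinv aX).
  move/(rinv_comp (fun t => t != 0))/rinv_aset; congr (aset c _).
  by apply/setP=> z; rewrite !inE subr0.
pose K := [set z *+ p | z : V].
have KP : zmod_closed K.
  split; first by apply/imsetP; exists 0; rewrite ?mul0rn.
  by move=> _ _ /imsetP[x _ ->] /imsetP[y _ ->]; rewrite -mulrnBl; apply/imsetP; exists (x - y).
(* Multiplication by [p] kills the [p]-torsion, so it is not injective and hence not onto. *)
have KT : K != setT.
  apply/eqP=> eKT; suff : (p <= 1)%N by rewrite leqNgt prime_gt1.
  have inj_p : {in [set: V] &, injective (fun z : V => z *+ p)}.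
    apply/imset_injP/eqP; rewrite -[in RHS]eKT; apply: eq_card => x.
    by apply/imsetP/imsetP => -[y _ ->]; exists y.
  rewrite -(card_torsion p_dvd) -(cards1 (0 : V)); apply/subset_leq_card/subsetP=> z.
  by rewrite !inE => /eqP zp0; apply/eqP/inj_p; rewrite ?inE // mul0rn.
have sZK : Z \subset K.
  apply/subsetP=> z; rewrite inE => nz; apply/imsetP.
  have /set0Pn[x] : [set x in X | x *+ p == z] != set0.
    by apply: contra nz => /eqP->; rewrite cards0.
  by rewrite inE => /andP[_ /eqP <-]; exists x.
have [W aW /andP[sZW sWK]] := asubgroup_gen aZ KP sZK.
have sWH : W \subset H.
  by apply: subH => //; apply: contra KT => /eqP eW; rewrite eW subTset in sWK.
set S := [set x in X | x *+ p == w *+ p].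
have : w *+ p \notin Z by apply: contra wpH => /(subsetP sZW)/(subsetP sWH).
rewrite inE negbK -(dvdn_pcharf (pchar_Fp p_pr)) -/S => p_S.
pose P := [set w + v | v in [set z : V | z *+ p == 0]].
have cardP : #|P| = p by rewrite card_imset ?card_torsion //; apply: addrI.
have sSP : S \subset P.
  apply/subsetP=> x; rewrite inE => /andP[_ /eqP e].
  by apply/imsetP; exists (x - w); rewrite ?subrKC // inE mulrnBl e subrr.
have S_gt0 : (0 < #|S|)%N by apply/card_gt0P; exists w; rewrite inE wX /=.
have /eqP eSP : S == P by rewrite eqEcard sSP cardP dvdn_leq.
have : w + u \in S by rewrite eSP; apply/imsetP; exists u; rewrite ?inE ?up0.
by rewrite inE => /andP[].
Qed.

Lemma basic_sub_nonzero x : x != 0 -> basic x \subset ~: [set 0].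
Proof.
case: cP => _ c0 _ x0; apply/subsetP=> z; rewrite !inE; apply: contraTneq => ->.
by apply: contra x0 => /eqP/esym/c0->.
Qed.

Lemma notin_basic0 x : x != 0 -> 0 \notin basic x.
Proof. by move/basic_sub_nonzero/subsetP=> s; apply/negP=> /s; rewrite !inE eqxx. Qed.

(** Schur's theorem on primitive Schur rings over cyclic groups of composite order N. Let P be the
    p-torsion. Without proper invariant subgroups, basic sets are unions of P-cosets off P, so every
    nonzero colour occurs in P. Let X be a smallest basic set and Y its part off P: the
    autocorrelation of X is at least |Y| at every nonzero point, and its sum is too large for X. *)
Theorem schur_imprimitive x0 y0 : ~~ prime n.+2 -> x0 != 0 -> y0 != 0 -> c x0 != c y0 ->
  exists2 H, asubgroup H & H != [set 0] /\ H != setT.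
Proof.
move=> npr x00 y00 c_xy; apply: contrapT => noH.
have subH W : asubgroup W -> W != setT -> W \subset [set 0].
  move=> aW WT; apply: contra_notT noH => W0; exists W => //; split=> //.
  by apply: contra W0 => /eqP->.
pose p := pdiv n.+2; have p_pr : prime p by apply: pdiv_prime.
have p_dvd : (p %| n.+2)%N by apply: pdiv_dvd.
have p_lt : (p < n.+2)%N.
  by rewrite ltn_neqAle pdiv_leq // andbT; apply: contra npr => /eqP <-.
pose P := [set u : V | u *+ p == 0]; have cardP : #|P| = p by apply: card_torsion.
have P_closed : zmod_closed P.
  split; first by rewrite inE mul0rn.
  by move=> u v; rewrite !inE => /eqP u0 /eqP v0; rewrite mulrnBl u0 v0 subrr.
have PT : P != setT.
  by apply: contraTneq p_lt => e; rewrite -cardP e cardsT card_ord ltnn.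
have coset X w u : aset c X -> w \in X -> w *+ p != 0 -> u \in P -> w + u \in X.
  move=> aX wX wp; rewrite inE => /eqP up; apply: (torsion_coset p_pr p_dvd aX subH) => //.
  by rewrite inE.
(* A basic set missing the torsion would have all of it among its periods. *)
have meetP x : x != 0 -> exists2 u, u \in P & c u = c x.
  move=> xn0; apply: contrapT => noP; pose X := basic x.
  have XP w : w \in X -> w *+ p != 0.
    by rewrite inE => /eqP cw; apply/eqP=> w0; apply: noP; exists w; rewrite ?inE ?w0.
  have stP : P \subset stab X.
    apply/subsetP=> u uP; rewrite inE; apply/forallP=> v; apply/eqP; apply/idP/idP => [h|vX].
      have uNP : - u \in P by rewrite zmod_opp.
      by have := coset _ _ _ (@aset_basic x) h (XP _ h) uNP; rewrite addrK.
    exact: (coset _ _ _ (@aset_basic x) vX (XP _ vX) uP).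
  have [|stT] := eqVneq (stab X) setT; last first.
    have := subset_leq_card (subset_trans stP (subH _ (asubgroup_stab (@aset_basic x)) stT)).
    by rewrite cardP cards1 leqNgt prime_gt1.
  move/setP/(_ (- x)); rewrite !inE => /forallP/(_ x).
  by rewrite subrr basic_id (negbTE (notin_basic0 xn0)).
have [x xn0 x_min] : exists2 x, x != 0 & forall y, y != 0 -> (#|basic x| <= #|basic y|)%N.
  by case: (@arg_minnP _ x0 (fun x => x != 0) (fun x => #|basic x|) x00) => x xn0 min; exists x.
have [y yn0 c_yx] : exists2 y, y != 0 & c y != c x.
  by have [e|] := eqVneq (c x0) (c x); [exists y0; rewrite // eq_sym -e|exists x0].
have [X eX] : exists X, X = basic x by exists (basic x).
have aX : aset c X by rewrite eX; apply: aset_basic.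
have half : (#|X|.*2 < n.+2)%N.
  have dis : [disjoint X & basic y].
    rewrite eX disjoint_subset; apply/subsetP=> z; rewrite !inE => /eqP->.
    by rewrite eq_sym.
  have : (#|X :|: basic y| <= #|~: [set (0%R : V)]|)%N.
    by apply: subset_leq_card; rewrite subUset eX !basic_sub_nonzero.
  rewrite cardsU (disjoint_setI0 dis) cards0 subn0 cardsC1 card_ord => le1.
  by have := x_min y yn0; rewrite -eX; lia.
pose Y := [set v in X | v *+ p != 0].
have ge_corr z : z != 0 -> (#|Y| <= corr X z)%N.
  move=> /meetP[u uP /(corr_aset aX) <-]; apply/subset_leq_card/subsetP=> v.
  by rewrite !inE => /andP[vX vp]; rewrite vX coset.
have Y_ge : (p <= #|Y|)%N.
  have [v vX vp] : exists2 v, v \in X & v *+ p != 0.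
    have nXP : ~~ (X \subset P).
      apply/negP=> sXP; have [W aW /andP[sXW sWP]] := asubgroup_gen aX P_closed sXP.
      have WT : W != setT.
        by apply: contra PT => /eqP eW; rewrite -subTset -eW.
      have := subsetP (subset_trans sXW (subH _ aW WT)) x.
      by rewrite eX basic_id inE (negbTE xn0) => /(_ isT).
    by have /subsetPn[v vX] := nXP; rewrite inE => vp; exists v.
  rewrite -cardP -(card_imset _ (@addrI _ v)); apply/subset_leq_card/subsetP.
  move=> _ /imsetP[u uP ->]; rewrite inE coset // mulrnDl.
  by move: uP; rewrite inE => /eqP->; rewrite addr0.
have X_le : (#|X| < #|Y| + p)%N.
  have -> : X = Y :|: (X :&: P).
    by apply/setP=> z; rewrite !inE; case: eqP; rewrite ?andbF ?andbT ?orbF // orbC /=.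
  apply: leq_ltn_trans (leq_card_setU _ _) _; rewrite ltn_add2l -cardP.
  apply/proper_card/properP; split; first exact: subsetIr.
  by exists 0; rewrite ?inE ?mul0rn ?eqxx // eX (negbTE (notin_basic0 xn0)).
have sum_le : (#|X| + n.+1 * #|Y| <= #|X| * #|X|)%N.
  have -> : (#|X| * #|X| = \sum_(u in [set: V]) corr X u)%N.
    rewrite sum_corr -[in LHS]sum_nat_const; apply: eq_bigr => v vX.
    by rewrite -(card_preimset _ (@addrI _ v)); apply: eq_card => u; rewrite !inE.
  rewrite (bigD1 (0 : V)) ?inE //= corr0 leq_add2l.
  rewrite -[(n.+1 * _)%N](_ : \sum_(u : V | u != 0%R) #|Y| = _)%N; last first.
    by rewrite sum_nat_const cardC1 card_ord.
  rewrite (eq_bigl (fun u : V => u != 0)) => [|u]; last by rewrite inE.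
  exact: leq_sum.
(* From 2 |X| <= N - 1 and |X| < 2 |Y| it follows that |X|^2 < (N - 1) |Y|. *)
nia.
Qed.

End SchurColoring.

(** * Sections of a cyclic group and quotient Schur rings *)

Definition section_map n (W : finZmodType) (U L : {set 'I_n.+2}) (f : 'I_n.+2 -> W) : Prop :=
  [/\ zmod_closed U, zmod_closed L, {in U &, forall x y, f (x - y) = f x - f y},
      forall x, x \in U -> (f x == 0) = (x \in L)
    & forall w, exists2 x, x \in U & f x = w].

Lemma section_card n (W : finZmodType) (U L : {set 'I_n.+2}) (f : 'I_n.+2 -> W) (X : {set W}) :
  L \subset U -> section_map U L f ->
  #|[set z in U | f z \in X]| = (#|L| * #|X|)%N.
Proof.
move=> /subsetP sLU [UP LP fB fker fsurj].
rewrite -sum1_card (partition_big f (mem X)) /=; last by move=> z; rewrite inE => /andP[].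
rewrite mulnC -sum_nat_const; apply: eq_bigr => w wX.
have [u uU fu] := fsurj w; rewrite -(card_imset _ (@addrI _ u)) -sum1_card.
apply: eq_bigl => z; rewrite inE; apply/andP/imsetP => [[/andP[zU _] /eqP fz]|[l lL ->]].
  exists (z - u); last by rewrite subrKC.
  have [_ UB] := UP.
  by rewrite -fker ?UB // fB // fz fu subrr.
have lU := sLU l lL; rewrite (zmod_add _ UP) //= lU.
have -> : f (u + l) = w; last by rewrite eqxx.
rewrite -[l]opprK fB // ?(zmod_opp _ UP) // fu.
have /eqP -> : f (- l) == 0 by rewrite fker ?(zmod_opp _ UP) // (zmod_opp _ LP).
by rewrite subr0.
Qed.

(** The map divides by the generator of [U]. The target is any copy of the integers modulo the
    index, because it will be a prime field or a ring ['I_m.+2] according to whether the index is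
    prime. *)
Lemma section_exists n (U L : {set 'I_n.+2}) : zmod_closed U -> zmod_closed L ->
  L \subset U -> L != U ->
  exists2 m, (1 < m)%N & forall W : finNzRingType,
    (forall k, (k%:R == 0 :> W) = (m %| k)%N) -> (forall w : W, exists k, w = k%:R) ->
    exists f : 'I_n.+2 -> W, section_map U L f.
Proof.
move=> UP LP sLU neqLU.
have [d [d0 dN dE]] := zmod_closed_multiples UP.
have [e [e0 eN eE]] := zmod_closed_multiples LP.
have de : (d %| e)%N.
  have [eltN|] := ltnP e n.+2; last first.
    by move=> leNe; suff -> : e = n.+2 by []; apply/eqP; rewrite eqn_leq leNe dvdn_leq.
  have : Ordinal eltN \in U by apply: (subsetP sLU); rewrite eE.
  by rewrite dE.
have eqN z k : (z = k%:R :> 'I_n.+2) -> z = k %[mod n.+2].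
  by move->; rewrite Zp_nat /= modn_mod.
exists (e %/ d)%N.
  rewrite ltn_divRL // mul1n ltn_neqAle dvdn_leq // andbT.
  by apply: contra neqLU => /eqP ed; apply/eqP/setP=> z; rewrite dE eE ed.
move=> W W0 Wnat; set m := (e %/ d)%N.
have em : e = (m * d)%N by rewrite divnK.
have m0 : (0 < m)%N by rewrite divn_gt0 // dvdn_leq.
have Wmod k l : k = l %[mod m] -> k%:R = l%:R :> W.
  have mod_m j : j%:R = (j %% m)%:R :> W.
    rewrite {1}(divn_eq j m) natrD natrM.
    have /eqP -> : (m%:R == 0 :> W) by rewrite W0.
    by rewrite mulr0 add0r.
  by move=> e_kl; rewrite mod_m e_kl -mod_m.
exists (fun z => (z %/ d)%:R); split=> //.
- move=> x y xU yU; have [_ UB] := UP; have xyU := UB _ _ xU yU.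
  apply/eqP; rewrite eq_sym subr_eq -natrD; apply/eqP/Wmod/eqP.
  rewrite dE in xU; rewrite dE in yU; rewrite dE in xyU.
  rewrite -(eqn_pmul2r d0) !muln_modl mulnDl !divnK //; apply/eqP.
  have := @eqN x ((x - y)%R + y)%N; rewrite natrD !natr_Zp subrK => /(_ erefl) e_mod.
  by rewrite -(modn_dvdm _ eN) e_mod modn_dvdm.
- move=> x xU; rewrite W0 eE {2}em dvdn_divRL -?dE //.
move=> w; have [k ->] := Wnat w; exists ((k %% m) * d)%:R.
  by rewrite dE Zp_nat /= /dvdn modn_dvdm // modnMl.
have lt_N : (k %% m * d < n.+2)%N.
  by apply: leq_trans (dvdn_leq _ eN); rewrite // [X in (_ < X)%N]em ltn_mul2r d0 ltn_mod.
by apply: Wmod; rewrite Zp_nat /= (modn_small lt_N) mulnK // modn_mod.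
Qed.

Section Transfer.
Variables (n m : nat) (T : eqType) (c : 'I_n.+2 -> T).
Variables (U L : {set 'I_n.+2}) (f : 'I_n.+2 -> 'I_m.+2).
Hypothesis cP : schur_coloring c.
Hypothesis aU : asubgroup c U.
Hypothesis aL : asubgroup c L.
Hypothesis sLU : L \subset U.
Hypothesis fP : section_map U L f.
Hypothesis Linv : forall z l, z \in U -> z \notin L -> l \in L -> c (z + l) = c z.

(** Colours off [L] are constant on [L]-cosets, so a class may take the colour of a representative;
    convolutions upstairs are #|L| times those of the quotient. *)
Lemma section_coloring : exists c' : 'I_m.+2 -> T,
  [/\ schur_coloring c', forall z, z \in U -> z \notin L -> c' (f z) = c z
    & forall W', asubgroup c' W' -> asubgroup c [set z in U | f z \in W']].
Proof.
have [cN c0 coh] := cP; have [UP aU'] := aU; have [LP aL'] := aL.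
have [_ _ fB fker fsurj] := fP; have [U0 UB] := UP.
(* The zero class is represented by 0 itself, whose colour occurs nowhere else. *)
have [g [g0 gU gK]] : exists g, [/\ g 0 = 0, forall x, g x \in U & forall x, f (g x) = x].
  have /choice[h hP] : forall x, exists z, z \in U /\ f z = x.
    by move=> x; have [z zU fz] := fsurj x; exists z.
  exists (fun x => if x == 0 then 0 else h x); rewrite eqxx.
  split=> // x; case: eqP => [x0|_]; rewrite ?x0 //; try by have [] := hP x.
  by apply/eqP; rewrite fker //; case: LP.
have f0L x : x \in U -> (f x == f 0) = (x \in L).
  by move=> xU; rewrite -fker //; have /eqP -> : f 0 == 0 by rewrite fker //; case: LP.
have fL x y : x \in U -> y \in U -> (f x == f y) = (x - y \in L).
  by move=> xU yU; rewrite -fker ?UB // fB // subr_eq0.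
have cg z : z \in U -> z \notin L -> c (g (f z)) = c z.
  move=> zU zL; rewrite -[g (f z)](subrKC z) Linv //.
  by rewrite -fL // gK.
have gL x : (g x \in L) = (x == 0) by rewrite -fker // gK.
pose c' x := c (g x).
have aset_lift X' : aset c' X' -> aset c [set z in U | f z \in X'].
  move=> aX' z z2 zz2; rewrite !inE (aU' _ _ zz2); case: (boolP (z2 \in U)) => //= z2U.
  have zU : z \in U by rewrite (aU' _ _ zz2).
  have [zL|zL] := boolP (z \in L).
    have z2L : z2 \in L by rewrite -(aL' _ _ zz2).
    suff -> : f z = f z2 by [].
    by apply/eqP; rewrite fL // -(zmod_add _ LP z2L) subrKC.
  by apply: aX'; rewrite /c' !cg // -(aL' _ _ zz2).
exists c'; split=> [|z zU zL|W' [[W0 WB] aW]]; last 2 first.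
- exact: cg.
- split; last exact: aset_lift.
  split; first by rewrite inE U0 /=; have /eqP -> : f 0 == 0 by rewrite fker //; case: LP.
  by move=> x y; rewrite !inE => /andP[xU fx] /andP[yU fy]; rewrite UB // fB // WB.
split=> [x|x|X' Y' aX' aY' x y xy].
- have [->|x0] := eqVneq x 0; first by rewrite oppr0.
  have gxL : - g x \notin L by rewrite (zmod_opp _ LP) gL.
  have gxU : - g x \in U by rewrite (zmod_opp _ UP).
  rewrite /c' -[c (g x)]cN -(cg _ gxU gxL); congr (c (g _)).
  have /eqP f0 : f 0 == 0 by rewrite fker //; case: LP.
  by rewrite -[- g x]sub0r fB // gK f0 sub0r.
- rewrite /c' g0 => /c0 gx0; apply/eqP; rewrite -gL gx0; by case: LP.
have L0 : (0 < #|L|)%N by apply/card_gt0P; exists 0; case: LP.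
have convE z : (#|L| * conv X' Y' z =
    conv [set z in U | f z \in X'] [set z in U | f z \in Y'] (g z))%N.
  rewrite /conv -(section_card _ sLU fP); apply: eq_card => w; rewrite !inE.
  case: (boolP (w \in U)) => //= wU; rewrite UB //= fB // gK.
  by [].
apply/eqP; rewrite -(eqn_pmul2l L0) !convE; apply/eqP.
by apply: coh xy; apply: aset_lift.
Qed.

End Transfer.

(** * The three shapes in rank four *)

Section Classification.
Variables (n : nat) (T : finType) (c : 'I_n.+2 -> T).
Hypothesis cP : schur_coloring c.
Local Notation V := 'I_n.+2.
Implicit Types (U L H K : {set V}).

Definition mono (X : {set V}) : Prop := {in X &, forall x y, c x = c y}.

(** For composite index, Schur's theorem applies to the quotient ring, and its invariant subgroup
    pulls back to one strictly between [L] and [U]. *)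
Lemma section_dichotomy U L x y : asubgroup c U -> asubgroup c L -> L \subset U ->
  (forall z l, z \in U -> z \notin L -> l \in L -> c (z + l) = c z) ->
  x \in U :\: L -> y \in U :\: L -> c x != c y ->
  (exists p, prime p /\ exists f : V -> 'F_p, section_map U L f) \/
  (exists2 W, asubgroup c W & L \proper W /\ W \proper U).
Proof.
move=> aU aL sLU Linv xUL yUL cxy.
have [UP aU'] := aU; have [LP aL'] := aL.
have /setDP[xU xL] := xUL; have /setDP[yU yL] := yUL.
have neq : L != U by apply: contraNneq xL => ->.
have [m m1 ex_f] := section_exists UP LP sLU neq.
have [m_pr|m_npr] := boolP (prime m).
  left; exists m; split=> //; apply: ex_f => [k|w]; last by exists (nat_of_ord w); rewrite natr_Zp.
  by rewrite (dvdn_pcharf (pchar_Fp m_pr)).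
right; case: m m1 ex_f m_npr => [|[|m]] // _ ex_f m_npr.
have [k|w|f fP] := ex_f 'I_m.+2; first exact: natr_Zp_eq0.
  by exists (nat_of_ord w); rewrite natr_Zp.
have [c' [c'P c'f c'W]] := section_coloring cP aU aL sLU fP Linv.
have [_ _ fB fker fsurj] := fP.
have nz z : z \in U -> z \notin L -> f z != 0 by move=> zU; rewrite fker.
have [|W' aW' [W'0 W'T]] := schur_imprimitive c'P m_npr (nz x xU xL) (nz y yU yL).
  by rewrite !c'f.
have [[W00 _] _] := aW'.
exists [set z in U | f z \in W']; first exact: c'W.
split; apply/properP; split.
- apply/subsetP=> z zL; have zU := subsetP sLU z zL.
  by rewrite inE zU; have /eqP -> : f z == 0 by rewrite fker.
- have /set0Pn[w] : W' :\ 0 != set0.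
    by apply: contra W'0; rewrite setD_eq0 eqEsubset sub1set W00 andbT.
  rewrite !inE => /andP[w0 wW]; have [z zU fz] := fsurj w; exists z.
    by rewrite inE zU fz.
  by rewrite -fker // fz.
- by apply/subsetP=> z; rewrite inE => /andP[].
have /subsetPn[w _ wW] : ~~ ([set: 'I_m.+2] \subset W') by rewrite subTset.
by have [z zU fz] := fsurj w; exists z; rewrite // inE zU fz.
Qed.

(** Two colours on [U :\: L] make the structure on F_p nontrivial, as the rigidity of slopes
    requires. *)
Definition prime_section_type : Prop := exists U L p (f : V -> 'F_p),
  [/\ prime p, asubgroup c U, asubgroup c L, L \subset U & section_map U L f] /\
  [/\ forall z l, z \in U -> z \notin L -> l \in L -> c (z + l) = c z,
      mono (L :\ 0), mono (~: U)
    & exists x y, [/\ x \in U :\: L, y \in U :\: L & c x != c y]].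

Definition chain_type : Prop := exists U L,
  [/\ asubgroup c U, asubgroup c L & L \subset U] /\
  [/\ mono (L :\ 0), mono (U :\: L) & mono (~: U)].

Definition tensor_type : Prop := exists H K,
  [/\ asubgroup c H, asubgroup c K, H :&: K \subset [set 0]
    & forall z, exists2 w, w \in H & z - w \in K] /\
  [/\ mono (H :\ 0), mono (K :\ 0) & mono (~: (H :|: K))].

Hypothesis rank4 : #|[set c z | z : V]| = 4.

Lemma three_colors a b d z : a != 0 -> b != 0 -> d != 0 ->
  c a != c b -> c a != c d -> c b != c d -> z != 0 -> [|| c z == c a, c z == c b | c z == c d].
Proof.
case: cP => _ c0 _ a0 b0 d0 ab ad bd z0.
have ne0 x : x != 0 -> c 0 != c x by apply: contra => /eqP/esym/c0->.
pose S := [set c 0; c a; c b; c d].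
have cardS : #|S| = 4.
  rewrite /S -!setUA !cardsU1 cards1 !inE !negb_or !ne0 //.
  by rewrite ab ad bd.
have eS : S = [set c z | z : V].
  apply/eqP; rewrite eqEcard cardS rank4 leqnn andbT.
  by apply/subsetP=> t; rewrite !inE -!orbA => /or4P[] /eqP->; apply: imset_f.
have : c z \in S by rewrite eS imset_f.
by rewrite !inE -!orbA eq_sym (negbTE (ne0 _ z0)).
Qed.

Lemma not_two_colors a b : exists2 z, z != 0 & (c z != a) && (c z != b).
Proof.
apply: contrapT => no; have : (#|[set c z | z : V]| <= #|[set c 0%R; a; b]|)%N.
  apply/subset_leq_card/subsetP=> _ /imsetP[z _ ->]; rewrite !inE -!orbA.
  apply/or3P; have [->|z0] := eqVneq z 0; first by constructor 1.
  have [->|za] := eqVneq (c z) a; first by constructor 2.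
  have [->|zb] := eqVneq (c z) b; first by constructor 3.
  by case: no; exists z; rewrite ?za.
rewrite rank4; apply/negP; rewrite -ltnNge.
by apply: leq_ltn_trans (leq_card_setU _ _) _; rewrite cards2 cards1; case: eqP.
Qed.

(** Three nonempty layers separated by invariant subgroups use up the three nonzero colours, one
    each. *)
Lemma chain_of_three U L a b d : asubgroup c U -> asubgroup c L -> L \subset U ->
  a \in L :\ 0 -> b \in U :\: L -> d \in ~: U -> chain_type.
Proof.
move=> aU aL sLU; have [[U0 _] aU'] := aU; have [[L0 _] aL'] := aL.
rewrite !inE => /andP[a0 aL0] /andP[bL bU] dU.
have b0 : b != 0 by apply: contraNneq bL => ->.
have d0 : d != 0 by apply: contraNneq dU => ->.
have aU0 := subsetP sLU a aL0.
have ab : c a != c b by apply: contraNneq bL => /aL' <-.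
have ad : c a != c d by apply: contraNneq dU => /aU' <-.
have bd : c b != c d by apply: contraNneq dU => /aU' <-.
have col z := three_colors a0 b0 d0 ab ad bd (z := z).
exists U, L; split=> //; split.
- suff h z : z \in L :\ 0 -> c z = c a by move=> x y /h-> /h->.
  rewrite !inE => /andP[z0 zL]; have /or3P[/eqP//|/eqP/aL' e|/eqP/aU' e] := col z z0.
    by rewrite -e zL in bL.
  by rewrite -e (subsetP sLU) in dU.
- suff h z : z \in U :\: L -> c z = c b by move=> x y /h-> /h->.
  rewrite !inE => /andP[zL zU]; have z0 : z != 0 by apply: contraNneq zL => ->.
  have /or3P[/eqP/aL' e|/eqP//|/eqP/aU' e] := col z z0; first by rewrite e aL0 in zL.
  by rewrite -e zU in dU.
suff h z : z \in ~: U -> c z = c d by move=> x y /h-> /h->.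
rewrite !inE => zU; have z0 : z != 0 by apply: contraNneq zU => ->.
by have /or3P[/eqP/aU' e|/eqP/aU' e|/eqP//] := col z z0; rewrite e ?aU0 ?bU in zU.
Qed.

Lemma zmod_closed0 : zmod_closed [set (0 : V)].
Proof. by split=> [|x y]; rewrite !inE // => /eqP-> /eqP->; rewrite subrr. Qed.

Lemma asubgroup0 : asubgroup c [set 0].
Proof. by split; [apply: zmod_closed0|apply: aset0]. Qed.

Lemma asubgroupT : asubgroup c [set: V].
Proof. by split; [split=> [|x y]; rewrite !inE|apply: asetT]. Qed.

Section Proper.
Variable H : {set V}.
Hypothesis aH : asubgroup c H.
Hypothesis H0 : H != [set 0].
Hypothesis HT : H != setT.

Let HP : zmod_closed H. Proof. by case: aH. Qed.
Let aH' : aset c H. Proof. by case: aH. Qed.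
Let zero_H : 0 \in H. Proof. by case: HP. Qed.

Let ex_h : exists2 h, h \in H & h != 0.
Proof.
have /set0Pn[h] : H :\ 0 != set0.
  by apply: contra H0; rewrite setD_eq0 eqEsubset sub1set zero_H andbT.
by rewrite !inE => /andP[h0 hH]; exists h.
Qed.

Let ex_g : exists g, g \notin H.
Proof.
have /subsetPn[g _ gH] : ~~ ([set: V] \subset H) by rewrite subTset.
by exists g.
Qed.

Lemma classify_two_inside x y : x \in H -> y \in H -> x != 0 -> y != 0 -> c x != c y ->
  prime_section_type \/ chain_type.
Proof.
move=> xH yH x0 y0 cxy; have [g gH] := ex_g.
have g0 : g != 0 by apply: contraNneq gH => ->.
have inx z : z \in H -> c z != c g by move=> zH; apply: contraNneq gH => /aH' <-.
have monoC : mono (~: H).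
  suff h z : z \in ~: H -> c z = c g by move=> u v /h-> /h->.
  rewrite inE => zH; have z0 : z != 0 by apply: contraNneq zH => ->.
  have /or3P[/eqP/aH' e|/eqP/aH' e|/eqP//] := three_colors x0 y0 g0 cxy (inx x xH) (inx y yH) z0.
    by rewrite e xH in zH.
  by rewrite e yH in zH.
have s0H : [set 0] \subset H by rewrite sub1set.
have Linv z l : z \in H -> z \notin [set 0] -> l \in [set 0] -> c (z + l) = c z.
  by move=> _ _; rewrite inE => /eqP->; rewrite addr0.
have xD : x \in H :\: [set 0] by rewrite !inE x0.
have yD : y \in H :\: [set 0] by rewrite !inE y0.
have [[p [p_pr [f fP]]]|[W aW [/properP[s0W [w wW w0]] /properP[sWH [v vH vW]]]]] :=
  section_dichotomy aH asubgroup0 s0H Linv xD yD cxy.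
  left; exists H, [set 0], p, f; split; first by split=> //; apply: asubgroup0.
  split=> //; last by exists x, y.
  by move=> u v; rewrite !inE => /andP[/negbTE->].
right; apply: (@chain_of_three H W w v g) => //; rewrite !inE ?wW ?vH ?vW ?gH //.
by rewrite inE in w0; rewrite w0.
Qed.

Hypothesis monoH : mono (H :\ 0).

Lemma classify_wreath :
  (forall z l, z \in [set: V] -> z \notin H -> l \in H -> c (z + l) = c z) ->
  prime_section_type \/ chain_type.
Proof.
move=> Linv; have [g gH] := ex_g; have [h hH h0] := ex_h.
have [y y0 /andP[yh yg]] := not_two_colors (c h) (c g).
have yH : y \notin H.
  by apply: contra yh => yH; apply/eqP/monoH; rewrite !inE ?y0 ?h0.
have gD : g \in [set: V] :\: H by rewrite !inE gH.
have yD : y \in [set: V] :\: H by rewrite !inE yH.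
have sHT : H \subset setT by apply: subsetT.
have [[p [p_pr [f fP]]]|[W aW [/properP[sHW [w wW wH]] /properP[sWT [v vT vW]]]]] :=
  section_dichotomy asubgroupT aH sHT Linv yD gD yg.
  left; exists setT, H, p, f; split; first by split=> //; apply: asubgroupT.
  split=> //; last by exists y, g.
  by move=> u v; rewrite !inE.
by right; apply: (@chain_of_three W H h w v) => //; rewrite !inE ?h0 ?wH ?vW.
Qed.

End Proper.

End Classification.

(** * Cosets with two colours *)

(** In the application [m] is the index and [h] the order of H. For each of the two outer colours,
    [s] is its size, [a] its share of a coset, [t] the number of its points z with p z off H, and
    [l] its autocorrelation at a nonzero point of H. Both colours satisfy (h - 1)(m - p) <= (m -
    1)(a - 1), and the sum contradicts m <= 2 (m - p). *)
Lemma no_large_index (m h p k : nat) (s a t l : bool -> nat) :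
  (1 < h)%N -> (1 < p)%N -> (1 < k)%N -> m = (k * p)%N ->
  (forall b, [/\ s b * h = (m * h - h) * a b, t b * h = (m * h - p * h) * a b,
     s b + h.-1 * l b = s b * a b, t b <= l b & 0 < a b])%N ->
  (a true + a false)%N = h -> False.
Proof.
move=> h1 p1 k1 em H sum_a.
have h0 : (0 < h)%N by lia.
have key b : (h.-1 * (m - p) <= m.-1 * (a b).-1)%N.
  have [s_eq t_eq corr_eq le_tl a0] := H b.
  have sE : s b = (m.-1 * a b)%N.
    apply/eqP; rewrite -(eqn_pmul2r h0) s_eq; apply/eqP.
    by rewrite -[X in (_ - X)%N]mul1n -mulnBl subn1; ring.
  have tE : t b = ((m - p) * a b)%N.
    by apply/eqP; rewrite -(eqn_pmul2r h0) t_eq -mulnBl; apply/eqP; ring.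
  rewrite -(leq_pmul2r a0).
  have : (h.-1 * t b <= s b * (a b).-1)%N.
    by rewrite -[(a b).-1]subn1 mulnBr muln1 -corr_eq addKn leq_mul2l le_tl orbT.
  rewrite tE sE => le1; rewrite -mulnA (leq_trans le1) //.
  by rewrite -!mulnA [(a b * _)%N]mulnC.
have := key true; have := key false.
have : (m <= (m - p).*2)%N by nia.
nia.
Qed.

(** The equation is that of a difference set of size k in a group of order 2k. Multiplied by 4 it
    reads 4 l (2k - 1) + 1 = (2k - 1)^2, so 2k - 1 divides 1. *)
Lemma no_half_design k l : (0 < k)%N -> (k + (2 * k).-1 * l = k * k)%N -> k = 1%N.
Proof.
case: k => // k _; have -> : (2 * k.+1).-1 = (2 * k).+1 by lia.
move=> e; have e4 : ((2 * k).+1 * (4 * l) + 1 = (2 * k).+1 * (2 * k).+1)%N by lia.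
have : ((2 * k).+1 %| 1)%N.
  by rewrite -(dvdn_addr 1 (dvdn_mulr (4 * l) (dvdnn (2 * k).+1))) e4 dvdn_mulr.
by rewrite dvdn1 => /eqP; lia.
Qed.

Section Tensor.
Variables (n : nat) (T : finType) (c : 'I_n.+2 -> T).
Hypothesis cP : schur_coloring c.
Local Notation V := 'I_n.+2.
Hypothesis rank4 : #|[set c z | z : V]| = 4.
Variable H : {set V}.
Hypothesis aH : asubgroup c H.
Hypothesis monoH : mono c (H :\ 0).
Variables h0 x y : V.
Hypothesis h0H : h0 \in H.
Hypothesis h0_neq0 : h0 != 0.
Hypothesis xH : x \notin H.
Hypothesis yH : y \notin H.
Hypothesis xyH : x - y \in H.
Hypothesis cxy : c x != c y.

Let HP : zmod_closed H. Proof. by case: aH. Qed.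
Let aH' : aset c H. Proof. by case: aH. Qed.
Let zero_H : 0 \in H. Proof. by case: HP. Qed.

Let nzC z : z \notin H -> z != 0. Proof. by apply: contraNneq => ->. Qed.

Let two z : z \notin H -> c z = c x \/ c z = c y.
Proof.
move=> zH; have ne u : u \notin H -> c h0 != c u by apply: contraNneq => /aH' <-.
have := three_colors cP rank4 h0_neq0 (nzC xH) (nzC yH) (ne x xH) (ne y yH) cxy (nzC zH).
by rewrite eq_sym (negbTE (ne z zH)) /= => /orP[] /eqP; [left|right].
Qed.

(* The two colours outside H, indexed so that arguments symmetric in them can be given once. *)
Let pt (b : bool) := if b then x else y.
Let X b := basic c (pt b).
Let aX b : aset c (X b). Proof. exact: aset_basic. Qed.
Let ptH b : pt b \notin H. Proof. by case: b. Qed.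
Let XH b z : z \in X b -> z \notin H.
Proof. by rewrite inE => /eqP/aH' ->. Qed.

Let Xcover z : z \notin H -> (z \in X true) || (z \in X false).
Proof. by rewrite !inE => /two[] ->; rewrite eqxx ?orbT. Qed.

Let a b := conv H (X b) x.

Let conv_shift b z l : l \in H -> conv H (X b) (z + l) = conv H (X b) z.
Proof.
move=> lH; rewrite /conv -(card_preimset _ (@addrI _ l)); apply: eq_card => w.
have e : z + l - (l + w) = z - w by ring.
by rewrite !inE (zmod_add _ HP) // e.
Qed.

(** [x] and [y] lie in one coset and have the only colours off [H], so all outer cosets contain
    equally many points of [X b]. *)
Let convC b z : z \notin H -> conv H (X b) z = a b.
Proof.
move=> zH; case: (two zH) => [cz|cz]; rewrite (conv_aset cP aH' (@aX b) cz) //.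
by rewrite -(@conv_shift b y (x - y)) // subrKC.
Qed.

Let a_sum : (a true + a false)%N = #|H|.
Proof.
rewrite /a /conv -cardsUI -[RHS]addn0; congr (_ + _)%N.
  apply: eq_card => w; rewrite !inE -andb_orr; case: (boolP (w \in H)) => //= wH.
  have : x - w \notin H by rewrite addrC (zmod_add _ HP) // (zmod_opp _ HP).
  by move/Xcover; rewrite !inE.
apply: eq_card0 => w; rewrite !inE; apply/negP => /andP[/andP[_ /eqP e1] /andP[_]].
by rewrite e1 (negbTE cxy).
Qed.

Let a_gt0 b : (0 < a b)%N.
Proof.
rewrite -(@convC b (pt b)) //; apply/card_gt0P; exists 0.
by rewrite !inE zero_H subr0 /=.
Qed.

(** If W leaves H it contains some [X b], which meets every outer coset, so H + W is everything. If
    W meets H outside 0, it contains H by [monoH] and is everything. Otherwise W is 0 with [X b],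
    since both colours together would put x - y into W; then H and W form a direct decomposition. *)
Let not_between W : ~ tensor_type c -> asubgroup c W -> W != setT -> W \subset H.
Proof.
move=> ntens aW WT; have [WP aW'] := aW; have [W0 _] := WP; apply: contrapT => /negP.
move=> /subsetPn[w wW wH].
have [b wX] : exists b, w \in X b by case/orP: (Xcover wH); [exists true|exists false].
have sXW : X b \subset W.
  by apply/subsetP=> z; rewrite inE => /eqP; move: wX; rewrite inE => /eqP <- /aW' ->.
have decomp z : exists2 u, u \in H & z - u \in 0 |: X b.
  have [zH|zH] := boolP (z \in H); first by exists z; rewrite // subrr !inE eqxx.
  have := a_gt0 b; rewrite -(@convC b z zH) => /card_gt0P[u]; rewrite inE => /andP[uH zu].
  by exists u; rewrite // inE zu orbT.
have sub0X : 0 |: X b \subset W by rewrite subUset sub1set W0.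
have HW0 : H :&: W \subset [set 0].
  apply/subsetP=> u; rewrite !inE => /andP[uH uW]; apply: contraR WT => u0.
  have sHW : H \subset W.
    apply/subsetP=> v vH; have [->//|v0] := eqVneq v 0.
    by rewrite (aW' v u) //; apply: monoH; rewrite !inE ?v0 ?u0.
  rewrite eqEsubset subsetT; apply/subsetP=> z _; have [v vH zv] := decomp z.
  by rewrite -[z](subrKC v) (zmod_add _ WP (subsetP sHW v vH)) (subsetP sub0X).
have WX z : z \in W -> z != 0 -> z \in X b.
  move=> zW z0; have zH : z \notin H.
    by apply: contra z0 => zH; have := subsetP HW0 z; rewrite !inE zH zW => ->.
  have [b' zX] : exists b', z \in X b' by case/orP: (Xcover zH); [exists true|exists false].
  have [<-//|neq_b] := eqVneq b' b.
  have sX'W : X b' \subset W.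
    by apply/subsetP=> u; rewrite inE => /eqP; move: zX; rewrite inE => /eqP <- /aW' ->.
  have ptW b1 : pt b1 \in W.
    have [e1|e1] : b1 = b \/ b1 = b'.
      by move: neq_b; case: (b); case: (b'); case: (b1) => //= _; [left|right|right|left].
    - by apply: (subsetP sXW); rewrite inE e1.
    by apply: (subsetP sX'W); rewrite inE e1.
  have := subsetP HW0 (x - y); rewrite !inE xyH /= => /(_ _)/eqP e.
  case/eqP: cxy; congr c; apply/eqP; rewrite -subr_eq0 e //.
  by case: WP => _; apply; [apply: (ptW true)|apply: (ptW false)].
apply: ntens; exists H, W; split; split=> //.
- by move=> z; have [u uH zu] := decomp z; exists u; rewrite ?(subsetP sub0X).
- move=> u v; rewrite !in_setD1 => /andP[u0 /WX/(_ u0)] + /andP[v0 /WX/(_ v0)].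
  by rewrite !inE => /eqP-> /eqP->.
suff other z : z \in ~: (H :|: W) -> z \in X (~~ b).
  by move=> u v /other + /other; rewrite !inE => /eqP-> /eqP->.
rewrite in_setC in_setU negb_or => /andP[zH zW].
have zX : z \notin X b by apply: contra zW => /(subsetP sXW).
by have := Xcover zH; move: zX; case: (b) => /= /negbTE->; rewrite ?orbF.
Qed.

Let count_in b (A : {set V}) : (forall z l, z \in A -> l \in H -> z + l \in A) ->
  {in A, forall z, z \notin H} -> (#|X b :&: A| * #|H| = #|A| * a b)%N.
Proof.
move=> AH AC; rewrite mulnC -!sum_nat_const.
have -> : (\sum_(z in A) a b = \sum_(z in A) \sum_(w in H | (z - w)%R \in X b) 1)%N.
  apply: eq_bigr => z zA; rewrite -(convC b (AC z zA)) /conv -sum1_card.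
  by apply: eq_bigl => w; rewrite inE.
rewrite (exchange_big_dep (mem H)) /=; last by move=> z w _ /andP[].
apply: eq_bigr => w wH; rewrite -(card_imset _ (@addrI _ w)) -sum1_card.
apply: eq_bigl => z; apply/imsetP/andP => [[v /setIP[vX vA] ->]|[zA /andP[_ zX]]].
  by rewrite addrC AH // wH addrK.
exists (z - w); rewrite ?subrKC // inE zX AH // ?(zmod_opp _ HP) //.
Qed.

(** Counts the pairs of points of [X b] in a common coset; by [monoH] all nonzero elements of [H]
    have the same autocorrelation. *)
Let sum_corrH b u0 : u0 \in H -> u0 != 0 ->
  (#|X b| + #|H|.-1 * corr (X b) u0 = #|X b| * a b)%N.
Proof.
move=> u0H u00; rewrite -sum_nat_const.
have -> : (\sum_(v in X b) a b = \sum_(v in X b) #|[set u in H | (v + u)%R \in X b]|)%N.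
  apply: eq_bigr => v vX; rewrite -(convC b (XH vX)) /conv -(card_preimset _ (@oppr_inj V)).
  by apply: eq_card => u; rewrite !inE (zmod_opp _ HP) // opprK.
rewrite -sum_corr (bigD1 0) //= corr0; congr (_ + _)%N.
rewrite [X in (X.-1 * _)%N](cardsD1 0 H) zero_H add1n -sum_nat_const.
rewrite [RHS](eq_bigl (mem (H :\ 0))); last by move=> u; rewrite !inE andbC.
apply: eq_bigr => u uH; apply: (corr_aset cP (@aX b)); apply: monoH => //.
by rewrite !inE u00.
Qed.

Let mulrnH z k : z \in H -> z *+ k \in H.
Proof. by move=> zH; elim: k => [|k IH]; rewrite ?mulr0n // mulrS (zmod_add _ HP). Qed.

Let X_gt0 b : pt b \in X b. Proof. exact: basic_id. Qed.

(** Otherwise multiplication by p keeps outer points outside H, and the p-torsion consists of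
    periods of [X true]. The periods then form a nonzero invariant subgroup of H, so y - x is one of
    them by [monoH], and y gets the colour of x. *)
Let prime_dvd_index m p : ~ tensor_type c -> (m %| n.+2)%N ->
  (forall z, (z \in H) = (m %| z)%N) -> prime p -> (p %| n.+2)%N -> (p %| m)%N.
Proof.
move=> ntens mN mE p_pr pN; apply: contraTT isT => pm.
have mulpH z : z \notin H -> z *+ p \notin H.
  apply: contra; rewrite !mE Zp_mulrn /= /dvdn modn_dvdm // -/(dvdn _ _) Gauss_dvdl //.
  by rewrite coprime_sym prime_coprime.
have subH W (aW : asubgroup c W) := not_between ntens aW.
have stP u : u *+ p = 0 -> u \in stab (X true).
  move=> up; rewrite inE; apply/forallP=> v; apply/eqP; apply/idP/idP => [vuX|vX].
    have := torsion_coset cP p_pr pN (@aX true) subH vuX (mulpH _ (XH vuX)) (u := - u).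
    by rewrite addrK => -> //; rewrite mulNrn up oppr0.
  exact: (torsion_coset cP p_pr pN (@aX true) subH vX (mulpH _ (XH vX)) up).
have [stT|stT] := eqVneq (stab (X true)) setT.
  have : - x \in stab (X true) by rewrite stT inE.
  rewrite inE => /forallP/(_ x); rewrite subrr.
  have -> : x \in X true by apply: X_gt0 true.
  by move/eqP/XH; rewrite zero_H.
have stH := subH _ (asubgroup_stab cP (@aX true)) stT.
have [_ astab] := asubgroup_stab cP (@aX true).
have [u uT u0] : exists2 u : V, u *+ p == 0 & u != 0.
  have : (1 < #|[set u : V | u *+ p == 0%R]|)%N by rewrite card_torsion ?prime_gt1.
  rewrite (cardsD1 0) inE mul0rn eqxx ltnS => /card_gt0P[u].
  by rewrite !inE => /andP[]; exists u.
have uH : u \in H by apply/(subsetP stH)/stP/eqP.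
have : y - x \in stab (X true).
  have yxH : y - x \in H by rewrite -(zmod_opp _ HP) opprB.
  rewrite (astab _ u); first exact/stP/eqP.
  apply: monoH; rewrite !inE ?uH ?yxH ?andbT //.
  by apply: contra cxy; rewrite subr_eq0 => /eqP->.
rewrite inE => /forallP/(_ x); have -> : x \in X true by apply: X_gt0 true.
by rewrite subrKC inE => /eqP/eqP e; case/eqP: cxy.
Qed.

(** Counting excludes every index other than p. For index p, multipliers make the two outer colours
    equally large, which forces p = 2, then |H| = 2 and order 4, where an outer point would have to
    be its own negative. *)
Lemma classify_tensor : tensor_type c.
Proof.
apply: contrapT => ntens.
have subH W (aW : asubgroup c W) := not_between ntens aW.
have [m [m0 mN mE]] := zmod_closed_multiples HP.
have HE : H = [set z : V | (m %| z)%N] by apply/setP=> z; rewrite inE mE.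
have cardH : #|H| = (n.+2 %/ m)%N by rewrite HE card_multiples.
have eN : n.+2 = (m * #|H|)%N by rewrite cardH mulnC divnK.
have h1 : (1 < #|H|)%N.
  by rewrite (cardsD1 0) zero_H ltnS; apply/card_gt0P; exists h0; rewrite !inE h0_neq0.
pose p := pdiv #|H|; have p_pr : prime p by apply: pdiv_prime.
have ph : (p %| #|H|)%N by apply: pdiv_dvd.
have pN : (p %| n.+2)%N by rewrite eN dvdn_mull.
have p_m : (p %| m)%N by apply: prime_dvd_index ntens mN mE p_pr pN.
have mulpE z : (z *+ p \in H) = (m %/ p %| z)%N.
  rewrite mE Zp_mulrn /= /dvdn modn_dvdm // -/(dvdn _ _) -{1}(divnK p_m).
  by rewrite dvdn_pmul2r ?prime_gt0.
pose A := [set z | z *+ p \notin H].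
have cardA : #|A| = (m * #|H| - p * #|H|)%N.
  have -> : A = ~: [set z : V | (m %/ p %| z)%N] by apply/setP=> z; rewrite !inE mulpE.
  have mpN : (m %/ p %| n.+2)%N by rewrite (dvdn_trans (dvdn_div p_m)).
  rewrite cardsCs setCK card_ord card_multiples //; congr (_ - _)%N; first exact: eN.
  suff gen N h : N = (m * h)%N -> (N %/ (m %/ p) = p * h)%N by apply: gen.
  move=> ->; rewrite -{1}(divnK p_m) -mulnA mulKn //.
  by rewrite divn_gt0 ?prime_gt0 // dvdn_leq.
have AH z l : z \in A -> l \in H -> z + l \in A.
  by rewrite !inE mulrnDl => + lH; rewrite addrC (zmod_add _ HP (@mulrnH l p lH)).
have AC : {in A, forall z, z \notin H} by move=> z; rewrite inE; apply/contra/mulrnH.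
have cardC : #|~: H| = (m * #|H| - #|H|)%N by rewrite cardsCs setCK card_ord -eN.
have CH z l : z \in ~: H -> l \in H -> z + l \in ~: H.
  by rewrite !inE => + lH; rewrite addrC (zmod_add _ HP).
have CC : {in ~: H, forall z, z \notin H} by move=> z; rewrite inE.
have XC b : X b :&: ~: H = X b by apply/setIidPl/subsetP=> z /XH; rewrite inE.
have s_eq b : (#|X b| * #|H| = (m * #|H| - #|H|) * a b)%N.
  by rewrite -cardC -(count_in b CH CC) XC.
have t_eq b : (#|X b :&: A| * #|H| = (m * #|H| - p * #|H|) * a b)%N.
  by rewrite -cardA -(count_in b AH AC).
have [u uT u0] : exists2 u : V, u *+ p == 0 & u != 0.
  have : (1 < #|[set u : V | u *+ p == 0%R]|)%N by rewrite card_torsion ?prime_gt1.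
  rewrite (cardsD1 0) inE mul0rn eqxx ltnS => /card_gt0P[u].
  by rewrite !inE => /andP[]; exists u.
have uH : u \in H.
  rewrite mE; move: uT; rewrite mulrn_Zp_eq0.
  suff gen N v : N = (m * #|H|)%N -> (N %| v * p)%N -> (m %| v)%N by apply: gen.
  move=> ->; rewrite -{1}(divnK ph) mulnA dvdn_pmul2r ?prime_gt0 //.
  by apply: dvdn_trans; apply: dvdn_mulr.
(* Inside [A], [X b] is a union of cosets of the torsion, so adding [u] stays in [X b]. *)
have le_t b : (#|X b :&: A| <= corr (X b) u)%N.
  apply/subset_leq_card/subsetP=> v /setIP[vX]; rewrite inE => vA; rewrite inE vX /=.
  exact: (torsion_coset cP p_pr pN (@aX b) subH vX vA (eqP uT)).
have [pm|neq_mp] := eqVneq m p; last first.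
  apply: (@no_large_index m #|H| p (m %/ p) (fun b => #|X b|) a
    (fun b => #|X b :&: A|) (fun b => corr (X b) u)) => //.
  - exact: prime_gt1.
  - by rewrite ltn_divRL // mul1n ltn_neqAle eq_sym neq_mp dvdn_leq.
  - by rewrite divnK.
  by move=> b; split=> //; apply: sum_corrH.
(* Every prime divisor of the order divides m = p, so outer points are units. *)
have co z : z \notin H -> coprime z n.+2.
  rewrite mE pm => pz; rewrite coprime_sym coprime_has_primes //; last first.
    by rewrite lt0n; apply: contraNneq pz => ->.
  apply/hasPn=> q; rewrite !mem_primes => /and3P[q_pr _ qz]; apply/negP=> /and3P[_ _ qN].
  have := prime_dvd_index ntens mN mE q_pr qN; rewrite pm dvdn_prime2 // => /eqP eq_qp.
  by rewrite -eq_qp qz in pz.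
(* The unit [pt b' / pt b] maps [X b] into [X b'], because multipliers preserve invariant sets. *)
have le_s b b' : (#|X b| <= #|X b'|)%N.
  have [k co_k ek] : exists2 k, coprime k n.+2 & pt b *+ k = pt b'.
    pose r : V := (pt b)^-1 * pt b'; exists (nat_of_ord r).
      have unitC z : z \notin H -> (z : 'Z_n.+2) \is a GRing.unit.
        by move/co; rewrite coprime_sym -(unitZpE _ (isT : 1 < n.+2)%N) natr_Zp.
      rewrite coprime_sym -(unitZpE _ (isT : 1 < n.+2)%N) natr_Zp.
      by rewrite unitrMl ?unitrV unitC ?ptH.
    rewrite -mulr_natr natr_Zp mulVKr //.
    by have := co _ (ptH b); rewrite coprime_sym -(unitZpE _ (isT : 1 < n.+2)%N) natr_Zp.
  have [l co_l kl] : exists2 l, coprime l n.+2 & forall z : V, z *+ k *+ l = z.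
    pose r : V := (k%:R : V)^-1; have ku : (k%:R : 'Z_n.+2) \is a GRing.unit.
      by rewrite unitZpE // coprime_sym.
    exists (nat_of_ord r) => [|z].
      by rewrite coprime_sym -(unitZpE _ (isT : 1 < n.+2)%N) natr_Zp unitrV.
    by rewrite -[RHS](mulrK ku) -[z *+ k *+ _]mulr_natr natr_Zp mulr_natr.
  have i_l := rinv_multiplier (schur_rcoh cP) co_l (aset_rinv (@aX b')).
  rewrite -(card_imset _ (Zp_mulrn_inj co_k)); apply/subset_leq_card/subsetP=> _ /imsetP[z zX ->].
  have ptb : pt b \in [set z *+ l | z in X b'].
    by apply/imsetP; exists (pt b'); rewrite // -ek kl.
  have : z \in [set z *+ l | z in X b'].
    have := rinv_aset i_l; move/(_ z (pt b)); rewrite !inE !subr0 => ->.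
      exact: ptb.
    by apply/eqP; move: zX; rewrite inE.
  case/imsetP=> w wX ->; suff -> : w *+ l *+ k = w by [].
  by rewrite -mulrnA mulnC mulrnA kl.
have eq_s : #|X true| = #|X false| by apply/eqP; rewrite eqn_leq !le_s.
have m1 : (1 < m)%N by rewrite pm prime_gt1.
have eq_a : a true = a false.
  have := s_eq true; rewrite eq_s s_eq => /eqP.
  by rewrite eqn_pmul2l => [/eqP->//|]; rewrite subn_gt0 ltn_Pmull // ltnW.
have eh : #|H| = (2 * a true)%N by rewrite -a_sum -eq_a mul2n addnn.
have p2 : p = 2.
  have : (2 %| m)%N.
    by apply: prime_dvd_index ntens mN mE _ _; rewrite // eN eh mulnCA dvdn_mulr.
  by rewrite pm dvdn_prime2 // => /eqP.
have sE : #|X true| = a true.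
  apply/eqP; rewrite -(eqn_pmul2r (ltnW h1)) s_eq pm p2 -[X in (_ - X)%N]mul1n -mulnBl.
  by rewrite mul1n mulnC.
have a1 : a true = 1%N.
  apply: (no_half_design (l := corr (X true) u) (a_gt0 true)).
  by have := @sum_corrH true u uH u0; rewrite sE eh.
have /cards1P[z eX] : #|X true| == 1%N by rewrite sE a1.
have : - x \in X true by rewrite (aset_opp cP _ (@aX true)); apply: X_gt0 true.
have : x \in X true by apply: X_gt0 true.
rewrite eX !inE => /eqP <- /eqP x_opp; case/negP: xH.
have : x *+ 2 == 0 by rewrite mulr2n -{1}x_opp addNr.
rewrite mE mulrn_Zp_eq0 pm p2.
have : n.+2 = (2 * 2)%N by rewrite {1}eN pm p2 eh a1.
by move: (nat_of_ord x) => k -> ; rewrite dvdn_pmul2r.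
Qed.

End Tensor.

(** Either the whole group over 0 is a prime section, or there is a proper invariant subgroup [H].
    It has two nonzero colours, or one; in the latter case colours are constant on outer cosets, or
    some outer coset has two colours and [classify_tensor] applies. *)
Theorem rank4_classification n (T : finType) (c : 'I_n.+2 -> T) :
  schur_coloring c -> #|[set c z | z : 'I_n.+2]| = 4 ->
  [\/ prime_section_type c, chain_type c | tensor_type c].
Proof.
move=> cP rank4; suff : (prime_section_type c \/ chain_type c) \/ tensor_type c.
  by case=> [[]|]; [constructor 1|constructor 2|constructor 3].
have [x x0 _] := not_two_colors rank4 (c 0) (c 0).
have [y y0 /andP[cyx _]] := not_two_colors rank4 (c x) (c x).
have s0T : [set (0 : 'I_n.+2)] \subset setT by apply: subsetT.
have Linv (z l : 'I_n.+2) : z \in [set: 'I_n.+2] -> z \notin [set 0] ->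
    l \in [set 0] -> c (z + l) = c z.
  by move=> _ _; rewrite inE => /eqP->; rewrite addr0.
have [||[p [p_pr [f fP]]]|[H aH [/properP[_ [h hH h0]] /properP[_ [g _ gH]]]]] :=
  section_dichotomy cP (asubgroupT c) (asubgroup0 cP) s0T Linv _ _ cyx; rewrite ?inE ?x0 ?y0 //.
  left; left; exists setT, [set 0], p, f; split.
    by split=> //; [apply: asubgroupT|apply: asubgroup0].
  split=> //; last by exists y, x; rewrite !inE x0 y0.
    by move=> u v; rewrite !inE => /andP[/negbTE->].
  by move=> u v; rewrite !inE.
rewrite inE in h0.
have H0 : H != [set 0] by apply: contraNneq h0 => eH; rewrite eH inE in hH.
have HT : H != setT by apply: contraNneq gH => ->; rewrite inE.
have [monoH|nmono] := pselect (mono c (H :\ 0)); last first.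
  left; have [u [v [uH vH cuv]]] : exists u v, [/\ u \in H :\ 0, v \in H :\ 0 & c u != c v].
    apply: contrapT => no; apply: nmono => u v uH vH; apply/eqP; apply: contrapT => /negP cuv.
    by apply: no; exists u, v.
  move: uH vH; rewrite !inE => /andP[u0 uH] /andP[v0 vH].
  exact: (classify_two_inside cP rank4 aH HT uH vH u0 v0 cuv).
have [Hinv|nHinv] := pselect (forall z l, z \in [set: 'I_n.+2] -> z \notin H -> l \in H ->
    c (z + l) = c z).
  by left; apply: (classify_wreath cP rank4 aH H0 HT monoH Hinv).
right; have [z [l [zH lH czl]]] : exists z l, [/\ z \notin H, l \in H & c (z + l) != c z].
  apply: contrapT => no; apply: nHinv => u v _ uH vH; apply/eqP; apply: contrapT => /negP cuv.
  by apply: no; exists u, v.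
have [HP _] := aH.
apply: (classify_tensor cP rank4 aH monoH hH h0 (x := z + l) (y := z)) => //.
  by rewrite addrC (zmod_add _ HP).
by rewrite addrC addKr.
Qed.

(** * Identification of circulant graphs of rank four *)

Section SetIso.
Variables (V V' : finType) (e : rel V) (e' : rel V').

Definition set_iso (A : {set V}) (A' : {set V'}) : Prop := exists h : V -> V',
  [/\ {in A &, injective h}, h @: A = A' & {in A &, forall x y, e x y = e' (h x) (h y)}].

Lemma set_isoT : set_iso setT setT -> graph_iso e e'.
Proof.
case=> h [inj_h imh eh]; exists h; split=> [|x y]; last by apply: eh; rewrite inE.
have injh : injective h by move=> x y; apply: inj_h; rewrite inE.
by apply: inj_card_bij => //; rewrite -cardsT -imh card_imset ?cardsT.
Qed.

(** One class is peeled off on each side. The constant adjacency [b] between classes makes the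
    pieces compatible, whatever isomorphisms are chosen on them. *)
Lemma set_iso_glue (v0 : V') (r : rel V) (r' : rel V') (b : bool) (A : {set V}) (A' : {set V'}) :
  equivalence_rel r -> equivalence_rel r' ->
  (forall x, x \in A -> [set y | r x y] \subset A) ->
  (forall x, x \in A' -> [set y | r' x y] \subset A') ->
  #|A| = #|A'| ->
  (forall x x', x \in A -> x' \in A' -> set_iso [set y | r x y] [set y | r' x' y]) ->
  {in A &, forall x y, ~~ r x y -> e x y = b} ->
  {in A' &, forall x y, ~~ r' x y -> e' x y = b} -> set_iso A A'.
Proof.
move=> /equivalence_relP[rxx rl] /equivalence_relP[rxx' rl'].
have rsym x y : r x y = r y x by apply/idP/idP => /rl <-.
have rsym' x y : r' x y = r' y x by apply/idP/idP => /rl' <-.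
have [k] := ubnP #|A|; elim: k A A' => // k IH A A' ltk clA clA' cardA iso eA eA'.
have [A0|/set0Pn[x xA]] := eqVneq A set0.
  exists (fun _ => v0); split=> [x y||x y]; rewrite ?A0 ?inE //.
  by rewrite imset0; apply/esym/eqP; rewrite -cards_eq0 -cardA A0 cards0.
have /card_gt0P[x' xA'] : (0 < #|A'|)%N by rewrite -cardA; apply/card_gt0P; exists x.
have [h1 [inj1 im1 eh1]] := iso x x' xA xA'.
set C := [set y | r x y] in inj1 im1 eh1; set C' := [set y | r' x' y] in im1.
have cardC : #|C| = #|C'| by rewrite -im1 card_in_imset.
have sCA : C \subset A := clA x xA; have sCA' : C' \subset A' := clA' x' xA'.
have [|y|y||y y'|y z|y z|h2 [inj2 im2 eh2]] := IH (A :\: C) (A' :\: C').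
- suff ltD : (#|A :\: C| < #|A|)%N by rewrite (leq_trans ltD) // -ltnS.
  apply/proper_card/properP; split; first exact: subsetDl.
  by exists x; rewrite // !inE rxx.
- rewrite inE => /andP[yC yA]; apply/subsetP=> z; rewrite inE => ryz.
  rewrite in_setD (subsetP (clA y yA)) ?inE // andbT.
  by apply: contra yC; rewrite !inE => xz; rewrite (rl _ _ xz) rsym.
- rewrite inE => /andP[yC yA]; apply/subsetP=> z; rewrite inE => ryz.
  rewrite in_setD (subsetP (clA' y yA)) ?inE // andbT.
  by apply: contra yC; rewrite !inE => xz; rewrite (rl' _ _ xz) rsym'.
- by rewrite !cardsD (setIidPr sCA) (setIidPr sCA') cardA cardC.
- by move=> /setDP[yA _] /setDP[yA' _]; apply: iso.
- by move=> /setDP[yA _] /setDP[zA _]; apply: eA.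
- by move=> /setDP[yA _] /setDP[zA _]; apply: eA'.
pose h y := if y \in C then h1 y else h2 y.
have hC y : y \in C -> h y \in C'.
  by move=> yC; rewrite /h yC -im1; apply: imset_f.
have hD y : y \in A -> y \notin C -> h y \in A' :\: C'.
  by move=> yA yC; rewrite /h (negbTE yC) -im2; apply: imset_f; rewrite inE yC.
have crossC y z : y \in C -> z \notin C -> ~~ r y z.
  by rewrite !inE => xy; apply: contra => /(rl _ _)/(_ x); rewrite rsym xy rsym => <-.
have crossC' y z : y \in C' -> z \notin C' -> ~~ r' y z.
  by rewrite !inE => xy; apply: contra => /(rl' _ _)/(_ x'); rewrite rsym' xy rsym' => <-.
exists h; split.
- move=> y z yA zA; case: (boolP (y \in C)) (boolP (z \in C)) => yC [] zC.
  + by rewrite /h yC zC; apply: inj1.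
  + by move=> e_h; have := hD z zA zC; rewrite -e_h inE hC.
  + by move=> e_h; have := hD y yA yC; rewrite e_h inE hC.
  by rewrite /h (negbTE yC) (negbTE zC); apply: inj2; rewrite inE ?yC ?zC.
- apply/setP=> w; apply/imsetP/idP => [[y yA ->]|wA'].
    have [yC|yC] := boolP (y \in C); first exact: (subsetP sCA') (hC y yC).
    by have /setDP[] := hD y yA yC.
  have [wC|wC] := boolP (w \in C').
    have /imsetP[y yC ->] : w \in h1 @: C by rewrite im1.
    by exists y; rewrite ?(subsetP sCA) // /h yC.
  have /imsetP[y /setDP[yA yC] ->] : w \in h2 @: (A :\: C) by rewrite im2 inE wC.
  by exists y; rewrite // /h (negbTE yC).
move=> y z yA zA; case: (boolP (y \in C)) (boolP (z \in C)) => yC [] zC.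
- by rewrite /h yC zC; apply: eh1.
- have /setDP[hzA hzC] := hD z zA zC; have hyC := hC y yC.
  by rewrite eA ?crossC // eA' ?crossC' // (subsetP sCA').
- have /setDP[hyA hyC] := hD y yA yC; have hzC := hC z zC.
  have nyz : ~~ r y z by rewrite rsym crossC.
  have nyz' : ~~ r' (h y) (h z) by rewrite rsym' crossC'.
  by rewrite eA // eA' // (subsetP sCA').
by rewrite /h (negbTE yC) (negbTE zC); apply: eh2; rewrite inE ?yC ?zC.
Qed.

Lemma set_iso_clique (v0 : V') (b : bool) (A : {set V}) (A' : {set V'}) : #|A| = #|A'| ->
  {in A &, forall x y, e x y = (x != y) && b} ->
  {in A' &, forall x y, e' x y = (x != y) && b} -> set_iso A A'.
Proof.
move=> cardA eA eA'; apply: (@set_iso_glue v0 eq_op eq_op b).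
- by apply/equivalence_relP; split=> [x|x y /eqP->].
- by apply/equivalence_relP; split=> [x|x y /eqP->].
- by move=> x xA; apply/subsetP=> y; rewrite inE => /eqP <-.
- by move=> x xA; apply/subsetP=> y; rewrite inE => /eqP <-.
- by [].
- move=> x x' xA xA'; exists (fun _ => x'); split.
  + by move=> y z; rewrite !inE => /eqP <- /eqP <-.
  + apply/setP=> y; rewrite inE; apply/imsetP/eqP => [[z _ ->]//|<-].
    by exists x; rewrite ?inE.
  by move=> y z; rewrite !inE => /eqP <- /eqP <-; rewrite eA // eA' // !eqxx.
- by move=> x y xA yA xy; rewrite eA // xy.
by move=> x y xA yA xy; rewrite eA' // xy.
Qed.

End SetIso.

(** * The colouring of the cyclic group by the closure *)

Section Circulant.
Variables (n : nat) (S : {set 'I_n.+2}).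
Local Notation V := 'I_n.+2.
Local Notation e := (circ_adj S).

Lemma circ_adjE (x y : V) : e x y = (y - x \in S).
Proof.
apply/exists_inP/idP => [[s sS /eqP exy]|yxS]; last first.
  by exists (y - x) => //; apply/eqP; rewrite -{2}(subrK x y).
suff <- : s = y - x by [].
by apply/eqP; rewrite -subr_eq opprK; apply/eqP/val_inj.
Qed.

Hypothesis connS : circ_conn S.

Lemma circ_conn_opp z : (- z \in S) = (z \in S).
Proof.
suff h u : u \in S -> - u \in S by apply/idP/idP => /h //; rewrite opprK.
have [_ +] := connS => /[apply] -[t tS ut0].
suff -> : - u = t by [].
by apply/eqP; rewrite eq_sym -addr_eq0 addrC; apply/eqP/val_inj.
Qed.

Lemma circ_conn0 : 0 \notin S.
Proof. by have [+ _] := connS => /(_ 0) h; apply/negP=> /h. Qed.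

Lemma circ_adj_sym (x y : V) : e x y = e y x.
Proof. by rewrite !circ_adjE -circ_conn_opp opprB. Qed.

Variable P : {set {set V * V}}.
Hypothesis closP : is_WL_closure e P.

Definition circ_color (z : V) : {set V * V} := pblock P (z, 0).

Let partP : partition P setT. Proof. by case: closP => -[]. Qed.
Let tiP : trivIset P. Proof. by case/and3P: partP. Qed.
Let coverP p : p \in cover P. Proof. by case/and3P: partP => /eqP->. Qed.

(** The orbits on pairs of the translations and reflections, all automorphisms of the graph. The
    closure is coarser, so the class of a pair depends only on its difference up to sign. *)
Let dihedral : rel (V * V) := fun p q =>
  (p.1 - p.2 == q.1 - q.2) || (p.1 - p.2 == q.2 - q.1).

Let dihedral_coherent : coherent_rel dihedral.
Proof.
have oppE (a b u v : V) : (a - b == u - v) = (b - a == v - u).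
  by rewrite -(opprB b a) -(opprB v u) (inj_eq oppr_inj).
split.
- apply/equivalence_relP; split=> [p|p q]; first by rewrite /dihedral eqxx.
  case/orP=> /eqP e1 r; rewrite /dihedral e1 //.
  by rewrite -(opprB q.1) !eqr_oppLR !opprB orbC.
- by move=> p q /orP[] /eqP e1; rewrite -subr_eq0 e1 subr_eq0 // eq_sym.
- by move=> x y x2 y2; rewrite /dihedral /= orbC oppE [X in _ || X]oppE orbC.
move=> x y x2 y2; rewrite /dihedral /= => /orP[] /eqP xy.
  exists (fun w => w - x + x2) => [w w2 /addIr/addIr//|w].
  have -> : x - w == x2 - (w - x + x2) by apply/eqP; ring.
  split=> //; have -> : w - x + x2 - y2 = w - y; last by rewrite eqxx.
  by rewrite -addrA -xy; ring.
exists (fun w => x2 + x - w) => [w w2 /addrI/oppr_inj//|w].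
have -> : (x - w == x2 + x - w - x2) by apply/eqP; ring.
split; first by rewrite orbT.
have -> : y2 - (x2 + x - w) = w - y; last by rewrite eqxx orbT.
have -> : y2 - (x2 + x - w) = (y2 - x2) - x + w by ring.
by rewrite -xy; ring.
Qed.

Let pblock_dihedral p q : dihedral p q -> pblock P p = pblock P q.
Proof.
apply: wl_closure_coarse dihedral_coherent _ _ closP _ p q => x y x2 y2.
rewrite /dihedral /= !circ_adjE => /orP[] /eqP xy.
  by rewrite -circ_conn_opp opprB xy -circ_conn_opp opprB.
by rewrite -xy -circ_conn_opp opprB.
Qed.

Lemma circ_colorB x y : pblock P (x, y) = circ_color (x - y).
Proof. by apply: pblock_dihedral; rewrite /dihedral /= subr0 eqxx. Qed.

Lemma circ_color_in z : circ_color z \in P.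
Proof. exact: pblock_mem. Qed.

Lemma circ_color_eq X (x y : V) : X \in P -> ((x, y) \in X) = (circ_color (x - y) == X).
Proof.
move=> XP; rewrite -circ_colorB; apply/idP/eqP => [|<-]; first exact: def_pblock.
by rewrite mem_pblock.
Qed.

Lemma circ_color_union (A : {set V * V}) x y x2 y2 : union_of_classes P A ->
  circ_color (x - y) = circ_color (x2 - y2) -> ((x, y) \in A) = ((x2, y2) \in A).
Proof.
move=> PA; rewrite -!circ_colorB => eq_b.
have xyb : (x, y) \in pblock P (x, y) by rewrite mem_pblock.
have xyb2 : (x2, y2) \in pblock P (x, y) by rewrite eq_b mem_pblock.
have [|/subsetP sA|dA] := PA (pblock P (x, y)); first exact: pblock_mem.
  by rewrite !sA.
by rewrite !(disjointFr dA).
Qed.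

Lemma circ_color_aset : aset circ_color S.
Proof.
move=> z z2 zz2; have [_ [uE _]] := closP.
have := circ_color_union (x := z) (y := 0) (x2 := z2) (y2 := 0) uE.
by rewrite !subr0 !inE /= !circ_adjE !sub0r !circ_conn_opp; apply.
Qed.

Lemma circ_color_schur : schur_coloring circ_color.
Proof.
have [[_ [uD _]] _] := closP; split=> [z|z z0|X Y aX aY z z2 zz2].
- by apply: pblock_dihedral; rewrite /dihedral /= subr0 sub0r eqxx orbT.
- have := circ_color_union (x := z) (y := 0) (x2 := 0) (y2 := 0) uD.
  by rewrite !subr0 !inE /= eqxx => /(_ z0)/eqP.
pose D (Z : {set V}) : {set V * V} := [set p | p.1 - p.2 \in Z].
have unionD Z : aset circ_color Z -> union_of_classes P (D Z).
  move=> aZ X0 X0P; have [e0|/set0Pn[[a b] /setIP[abX abZ]]] := eqVneq (X0 :&: D Z) set0.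
    by right; rewrite -setI_eq0 e0.
  left; apply/subsetP=> -[a2 b2]; move: abX abZ.
  by rewrite !(circ_color_eq _ _ X0P) !inE /= => /eqP <- abZ /eqP/aZ ->.
have convE u : conv X Y u = #|[set g | ((u, g) \in D Y) && ((g, 0) \in D X)]|.
  by apply: eq_card => w; rewrite !inE /= subr0 andbC.
rewrite !convE; have [cohP _] := closP.
apply: (coherent_count cohP (unionD Y aY) (unionD X aX) (circ_color_in z)).
  by rewrite circ_color_eq ?circ_color_in // subr0.
by rewrite circ_color_eq ?circ_color_in // subr0 zz2.
Qed.

Lemma card_circ_color : #|[set circ_color z | z : V]| = #|P|.
Proof.
congr #|pred_of_set _|; apply/setP=> X; apply/imsetP/idP => [[z _ ->]|XP].
  exact: circ_color_in.
have [_ _ /negP P0] := and3P partP.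
have /set0Pn[[x y] xyX] : X != set0 by apply: contraTneq XP => ->; apply/negP.
by exists (x - y) => //; rewrite -circ_colorB (def_pblock tiP XP).
Qed.

(** Having equal stable colours on triples (x, x, y) is a coherent equivalence on pairs (x, y),
    since the repeated pebble is free to reach the third point of a triangle. *)
Lemma sim3_color x y u x2 y2 u2 :
  sim3 e e u x y u2 x2 y2 -> circ_color (x - y) = circ_color (x2 - y2).
Proof.
move=> s; rewrite -!circ_colorB.
pose R : rel (V * V) := fun p q => `[< sim3 e e p.1 p.1 p.2 q.1 q.1 q.2 >].
have cR : coherent_rel R.
  split.
  - apply/equivalence_relP; split=> [p|p q /asboolP pq r].
      apply/asboolP; have := wl_sim_auto (triple p.1 p.1 p.2) (a := id) (e := e).
      rewrite /sim3 (_ : [ffun i => _] = triple p.1 p.1 p.2); first by apply=> //; exists id.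
      by apply/ffunP=> i; rewrite ffunE.
    apply/asboolP/asboolP; first exact: sim3_trans (sim3_sym pq).
    exact: sim3_trans pq.
  - by move=> p q /asboolP/sim3_atom[].
  - move=> a b a2 b2 /asboolP /= /sim3_copy[_ _ _ /sim3_copy[_ _ _ _ [aba _]] _].
    by apply/asboolP; case: (sim3_copy aba).
  move=> a b a2 b2 /asboolP /= /sim3_step[f bij_f fP].
  exists f => [|w]; first exact: bij_inj.
  have [_ awb aaw] := fP w; split; apply/asboolP => //=.
  by case: (sim3_copy awb).
apply: (wl_closure_coarse cR closP) => [a b a2 b2 /asboolP /=|].
  exact: sim3_edge.
apply/asboolP => /=; have [_ _ _ _ [_]] := sim3_copy s.
by have [] := sim3_copy s.
Qed.

Lemma sim3_translate x y : sim3 e e x x x y y y.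
Proof.
have := wl_sim_auto (triple x x x) (a := fun z => z + (y - x)) (e := e).
rewrite /sim3 (_ : [ffun i => _] = triple y y y).
  by apply=> [|u v]; [exists (fun z => z - (y - x)) => z; rewrite ?addrK ?subrK|
    rewrite !circ_adjE; congr (_ \in S); ring].
by apply/ffunP=> i; rewrite !ffunE; case: ifP => _; [|case: ifP => _]; rewrite subrKC.
Qed.

End Circulant.

(** * Isomorphisms from the three-pebble game *)

Section Identify.
Variables (n : nat) (S : {set 'I_n.+2}).
Local Notation V := 'I_n.+2.
Local Notation e := (circ_adj S).
Hypothesis connS : circ_conn S.
Variable P : {set {set V * V}}.
Hypothesis closP : is_WL_closure e P.
Variables (V' : finType) (e' : rel V').
Hypothesis simple_e' : simple_graph e'.
Hypothesis nd : ~ wl_distinguishes e e' 3.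

Let c := circ_color P.
Let cP : schur_coloring c. Proof. exact: circ_color_schur connS _ closP. Qed.
Let aS : aset c S. Proof. exact: circ_color_aset connS _ closP. Qed.

Let sim3_any x x' : sim3 e e' x x x x' x' x'.
Proof.
have [y s] := sim3_diag_cover nd x'.
exact: sim3_trans (sim3_translate S x y) s.
Qed.

(** A pair of [V'] receives the colour of a pair matching it in the game; by [sim3_color] the choice
    is immaterial. *)
Let color_ex : exists c' : V' -> V' -> {set V * V}, forall x y z x' y' z',
  sim3 e e' x y z x' y' z' ->
  [/\ c (x - y) = c' x' y', c (x - z) = c' x' z' & c (y - z) = c' y' z'].
Proof.
have /choice[g gP] : forall p : V' * V', exists q : V * V,
    sim3 e e' q.1 q.2 q.2 p.1 p.2 p.2.
  move=> [x' y']; have [x [y [z s]]] := sim3_cover nd x' y' y'.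
  by exists (x, y) => /=; case: (sim3_copy s) => _ _ _ _ [].
exists (fun x' y' => c ((g (x', y')).1 - (g (x', y')).2)).
have key x y x' y' : sim3 e e' x y y x' y' y' ->
    c (x - y) = c ((g (x', y')).1 - (g (x', y')).2).
  move=> s; have s3 := sim3_trans s (sim3_sym (gP (x', y'))).
  by have [_ _ /(sim3_color connS closP)] := sim3_copy s3.
move=> x y z x' y' z' s; have [yyz _ _ xzz [_ xyy]] := sim3_copy s.
by split; [apply: key xyy|apply: key xzz|apply: key; case: (sim3_copy yyz)].
Qed.

Section Color.
Variable c' : V' -> V' -> {set V * V}.
Hypothesis c'P : forall x y z x' y' z', sim3 e e' x y z x' y' z' ->
  [/\ c (x - y) = c' x' y', c (x - z) = c' x' z' & c (y - z) = c' y' z'].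

Let inC (X : {set V}) (t : {set V * V}) := t \in c @: X.

Let inCE X z : aset c X -> inC X (c z) = (z \in X).
Proof. by move=> aX; apply/imsetP/idP => [[v vX /aX ->]|zX]; [|exists z]. Qed.

(* The coset relation of the invariant subgroup H, transported to the other graph. *)
Let rH (H : {set V}) : rel V' := fun x' y' => inC H (c' x' y').
Let rV (H : {set V}) : rel V := fun x y => x - y \in H.

Let rV_equiv (H : {set V}) : zmod_closed H -> equivalence_rel (rV H).
Proof.
move=> HP; have [H0 HB] := HP; apply/equivalence_relP; rewrite /rV; split=> [x|x y xy z].
  by rewrite subrr.
have -> : x - z = (x - y) + (y - z) by ring.
exact: zmod_add.
Qed.

Let rH_equiv H : asubgroup c H -> equivalence_rel (rH H).
Proof.
move=> [HP aH]; apply/equivalence_relP; rewrite /rH; split=> [x'|x' y' + z'].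
  have [x s] := sim3_diag_cover nd x'; have [<- _ _] := c'P s.
  by rewrite inCE // subrr; case: HP.
have [x [y [z s]]] := sim3_cover nd x' y' z'; have [<- <- <-] := c'P s.
rewrite !inCE // => xy.
have -> : x - z = (x - y) + (y - z) by ring.
exact: zmod_add.
Qed.

(** Through such a [z], facts about [S] and the colouring reach the other graph. *)
Let edge_color x' y' : exists z,
  [/\ c z = c' x' y', e' x' y' = (z \in S) & (z == 0) = (x' == y')].
Proof.
have [x [y [z s]]] := sim3_cover nd x' y' y'; have [xy _ _] := c'P s.
have [_ _ _ _ [_ xyy]] := sim3_copy s; have [_ _ xxy _ _] := sim3_copy xyy.
exists (x - y); split=> //; last by rewrite subr_eq0; case: (sim3_atom s).
by rewrite -(sim3_edge xxy) circ_adj_sym // circ_adjE.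
Qed.

Let card_class H x' : aset c H -> #|[set y' | rH H x' y']| = #|H|.
Proof.
move=> aH; have [f bij_f fP] := sim3_step (sim3_any 0 x').
have injf := bij_inj bij_f; rewrite -(card_preimset _ (@oppr_inj V)) -(card_imset _ injf).
apply: eq_card => y'; rewrite inE; have [g fK gK] := bij_f.
rewrite -[y'](gK y') (mem_imset _ _ injf) !inE.
by have [_ _ /c'P[_ + _]] := fP (g y'); rewrite /rH sub0r => <-; rewrite inCE.
Qed.

Let card_classV H x : #|[set y | rV H x y]| = #|H|.
Proof.
rewrite -(card_preimset _ (@subrI _ x)); apply: eq_card => y.
by rewrite !inE /rV subKr.
Qed.

Let card_VV' : #|V| = #|V'|.
Proof. by have [x' _] := sim3_diag nd 0; have [f /bij_eq_card] := sim3_step (sim3_any 0 x'). Qed.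

Let mono_bool (X : {set V}) : mono c X -> exists b, forall z, z \in X -> (z \in S) = b.
Proof.
move=> mX; have [->|/set0Pn[x xX]] := eqVneq X set0; first by exists true => z; rewrite inE.
by exists (x \in S) => z zX; apply/aS/mX.
Qed.

Let glue U : asubgroup c U -> mono c (~: U) ->
  (forall x x', set_iso e e' [set y | rV U x y] [set y' | rH U x' y']) -> graph_iso e e'.
Proof.
move=> aU /mono_bool[b bP] iso; have [UP aU'] := aU; have [v0 _] := sim3_diag nd 0.
apply: set_isoT; apply: (@set_iso_glue _ _ e e' v0 (rV U) (rH U) b) => //.
- exact: rV_equiv.
- exact: rH_equiv.
- by rewrite !cardsT.
- by move=> x y _ _ xy; rewrite circ_adj_sym // circ_adjE bP // inE.
move=> x' y' _ _; rewrite /rH; have [z [<- -> _]] := edge_color x' y'.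
by rewrite inCE // => zU; rewrite bP // inE.
Qed.

(** Two nested gluings: cosets of [L] are complete or edgeless, and are joined uniformly within a
    coset of [U], as cosets of [U] are in the whole graph. *)
Lemma chain_iso : chain_type c -> graph_iso e e'.
Proof.
case=> U [L [[aU aL sLU] [mL mU mC]]]; apply: (glue aU mC) => x x'.
have [UP aU'] := aU; have [LP aL'] := aL.
have [b bP] := mono_bool mL; have [b2 b2P] := mono_bool mU; have [v0 _] := sim3_diag nd 0.
have L_sub x0 y0 : rV L x0 y0 -> rV U x0 y0 by apply: (subsetP sLU).
have L_sub' x0 y0 : rH L x0 y0 -> rH U x0 y0.
  rewrite /rH; have [z [<- _ _]] := edge_color x0 y0; rewrite !inCE //.
  exact: (subsetP sLU).
have /equivalence_relP[rUxx rUl] := rV_equiv UP.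
have /equivalence_relP[rUxx' rUl'] := rH_equiv aU.
apply: (@set_iso_glue _ _ e e' v0 (rV L) (rH L) b2).
- exact: rV_equiv.
- exact: rH_equiv.
- move=> y; rewrite inE => xy; apply/subsetP=> z; rewrite !inE => /L_sub yz.
  by rewrite (rUl _ _ xy).
- move=> y; rewrite inE => xy; apply/subsetP=> z; rewrite !inE => /L_sub' yz.
  by rewrite (rUl' _ _ xy).
- by rewrite card_class // card_classV.
- move=> y y' _ _; apply: (@set_iso_clique _ _ e e' v0 b).
  + by rewrite card_class // card_classV.
  + move=> u v; rewrite !inE => yu yv; have [->|neq_uv] := eqVneq u v.
      by rewrite circ_adjE subrr (negbTE (circ_conn0 connS)).
    have /equivalence_relP[_ rLl] := rV_equiv LP.
    rewrite circ_adj_sym // circ_adjE bP // !inE subr_eq0 neq_uv /=.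
    by rewrite (rLl _ _ yu) in yv.
  move=> u v; rewrite !inE => yu yv; have /equivalence_relP[_ rLl] := rH_equiv aL.
  rewrite (rLl _ _ yu) in yv; move: yv; rewrite /rH.
  have [z [<- -> z0]] := edge_color u v; rewrite inCE // -z0 => zL.
  have [->|zn0] := eqVneq z 0; first by rewrite (negbTE (circ_conn0 connS)).
  by rewrite bP // !inE zn0.
- move=> u v; rewrite !inE => xu xv uv; rewrite circ_adj_sym // circ_adjE b2P //.
  by rewrite inE uv; rewrite (rUl _ _ xu) in xv.
move=> u v; rewrite !inE => xu; rewrite (rUl' _ _ xu) /rH.
have [z [<- -> _]] := edge_color u v; rewrite !inCE // => zU zL.
by rewrite b2P // inE zL.
Qed.

Section PrimeSection.
Variables (U L : {set V}) (p : nat) (f : V -> 'F_p).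
Hypothesis p_pr : prime p.
Hypothesis aU : asubgroup c U.
Hypothesis aL : asubgroup c L.
Hypothesis sLU : L \subset U.
Hypothesis fP : section_map U L f.
Hypothesis Linv : forall z l, z \in U -> z \notin L -> l \in L -> c (z + l) = c z.
Hypothesis monoL : mono c (L :\ 0).
Variables s0 r0 : V.
Hypothesis s0U : s0 \in U :\: L.
Hypothesis r0U : r0 \in U :\: L.
Hypothesis c_sr : c s0 != c r0.

Let UP : zmod_closed U. Proof. by case: aU. Qed.
Let LP : zmod_closed L. Proof. by case: aL. Qed.
Let aU' : aset c U. Proof. by case: aU. Qed.
Let aL' : aset c L. Proof. by case: aL. Qed.

Let f0 u : u \in U -> (f u == 0) = (u \in L).
Proof. by case: fP => _ _ _ h _; apply: h. Qed.

Let fB u v : u \in U -> v \in U -> f (u - v) = f u - f v.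
Proof. by case: fP => _ _ h _ _; apply: h. Qed.

Let feq u v : u \in U -> v \in U -> (f u == f v) = (u - v \in L).
Proof. by move=> uU vU; rewrite -subr_eq0 -fB // f0 //; case: UP => _; apply. Qed.

Variable x : V.

(** Positions of the circulant graph against itself with one pebble resting on [x], read modulo [L]
    with [x] as origin. *)
Let slope_rel a b a2 b2 := exists y z y2 z2,
  [/\ y - x \in U, z - x \in U & sim3 e e x y z x y2 z2] /\
  [/\ a = f (y - x), b = f (z - x), a2 = f (y2 - x) & b2 = f (z2 - x)].

Let sim3_UL (X : {set V}) y z y2 z2 : aset c X -> sim3 e e x y z x y2 z2 ->
  (y - x \in X) = (y2 - x \in X) /\ (z - x \in X) = (z2 - x \in X).
Proof.
move=> aX s; have [_ _ _ xzz [_ xyy]] := sim3_copy s.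
have oppE v v2 : c (x - v) = c (x - v2) -> (v - x \in X) = (v2 - x \in X).
  by rewrite -(opprB x v) -(opprB x v2) !(aset_opp cP _ aX) => /aX.
have colE v v2 : sim3 e e x v v x v2 v2 -> c (x - v) = c (x - v2).
  by move=> /sim3_copy[_ _ /(sim3_color connS closP)].
by split; apply/oppE/colE.
Qed.

(** Counting residues with multiplicity #|L| turns a count over F_p into one over [U], where the
    game bijection acts. *)
Let slope_coh : rcoh slope_rel.
Proof.
move=> F G iF iG a b a2 b2 [y [z [y2 [z2 [[yU zU s] [-> -> -> ->]]]]]].
have [y2U z2U] := sim3_UL aU' s; rewrite yU in y2U; rewrite zU in z2U.
have L0 : (0 < #|L|)%N by apply/card_gt0P; exists 0; case: LP.
apply/eqP; rewrite -(eqn_pmul2l L0) -!(section_card _ sLU fP) eq_sym.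
have [g bij_g gP] := sim3_step s; have injg := bij_inj bij_g.
pose h v := g (v + x) - x; have injh : injective h.
  by move=> u v /addIr/injg/addIr.
rewrite -(card_preimset _ injh); apply/eqP/eq_card => v; rewrite !inE.
have [_ s1 s2] := gP (v + x).
have [_ U1] := sim3_UL aU' s2; rewrite addrK in U1.
rewrite /h -U1; case: (boolP (v \in U)) => //= vU; congr (_ && _).
  by apply/esym/iF; exists y, (v + x), y2, (g (v + x)); rewrite addrK; split; split.
by apply/esym/iG; exists (v + x), z, (g (v + x)), z2; rewrite addrK; split; split.
Qed.

Let slope_unique y z y2 z2 : sim3 e e x y z x y2 z2 -> y - x \in U :\: L -> z - x \in U ->
  f (z2 - x) / f (y2 - x) = f (z - x) / f (y - x).
Proof.
move=> s /setDP[yU yL] zU.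
have /setDP[s0U' s0L] := s0U; have /setDP[r0U' r0L] := r0U.
(* The residues of one colour, well defined because colours are constant on [L]-cosets off [L];
   [f s0] lies inside and [f r0] outside. *)
pose Sb := f @: [set v in U :\: L | c v == c s0].
have SbE v : v \in U -> (f v \in Sb) = (v \notin L) && (c v == c s0).
  move=> vU; apply/imsetP/andP => [[w]|[vL cv]]; last by exists v; rewrite // !inE vL vU.
  rewrite !inE => /andP[/andP[wL wU] cw] /eqP; rewrite feq // => vwL.
  have cvw : c v = c w by rewrite -(Linv wU wL vwL) subrKC.
  by rewrite cvw -(aL' cvw) in wL *.
have i0 : rinv slope_rel (fun a _ => a == 0).
  move=> a b a2 b2 [y1 [z1 [y3 [z3 [[y1U z1U s1] [-> _ -> _]]]]]].
  have [y3U _] := sim3_UL aU' s1; rewrite y1U in y3U.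
  by rewrite !f0 //; have [] := sim3_UL aL' s1.
have colE y1 z1 y3 z3 : sim3 e e x y1 z1 x y3 z3 -> c (y1 - z1) = c (y3 - z3).
  by move/(sim3_color connS closP).
have [_ UB] := UP.
have diffU y1 z1 : y1 - x \in U -> z1 - x \in U -> y1 - z1 \in U.
  move=> y1U z1U; have -> : y1 - z1 = (y1 - x) - (z1 - x) by ring.
  exact: UB.
have fdiff y1 z1 : y1 - x \in U -> z1 - x \in U -> f (y1 - x) - f (z1 - x) = f (y1 - z1).
  by move=> y1U z1U; rewrite -fB //; congr f; ring.
have ieq : rinv slope_rel (fun a b => a == b).
  move=> a b a2 b2 [y1 [z1 [y3 [z3 [[y1U z1U s1] [-> -> -> ->]]]]]].
  have [y3U z3U] := sim3_UL aU' s1; rewrite y1U in y3U; rewrite z1U in z3U.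
  have feqL y4 z4 : y4 - x \in U -> z4 - x \in U -> (f (y4 - x) == f (z4 - x)) = (y4 - z4 \in L).
    move=> y4U z4U; rewrite feq //; suff -> : y4 - x - (z4 - x) = y4 - z4 by [].
    by ring.
  by rewrite !feqL // (aL' (colE _ _ _ _ s1)).
have iS : rinv slope_rel (fun a b => a - b \in Sb).
  move=> a b a2 b2 [y1 [z1 [y3 [z3 [[y1U z1U s1] [-> -> -> ->]]]]]].
  have [y3U z3U] := sim3_UL aU' s1; rewrite y1U in y3U; rewrite z1U in z3U.
  rewrite (fdiff y1 z1 y1U z1U) (fdiff y3 z3 (esym y3U) (esym z3U)).
  rewrite (SbE _ (diffU y1 z1 y1U z1U)) (SbE _ (diffU y3 z3 (esym y3U) (esym z3U))) (colE _ _ _ _ s1).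
  by rewrite (aL' (colE _ _ _ _ s1)).
have s0S : f s0 \in Sb by rewrite SbE // s0L eqxx.
have r0S : f r0 \notin Sb by rewrite SbE // r0L eq_sym.
have s0n : f s0 != 0 by rewrite f0.
have r0n : f r0 != 0 by rewrite f0.
have yn : f (y - x) != 0 by rewrite f0.
have rel : slope_rel (f (y - x)) (f (z - x)) (f (y2 - x)) (f (z2 - x)).
  by exists y, z, y2, z2.
by have [] := slope_rigidity p_pr slope_coh i0 ieq iS s0S s0n r0S r0n rel yn.
Qed.

(* A point u outside the L-coset of x makes the remaining points of the U-coset of x
   distinguishable modulo L, and moving a point inside its L-coset does not affect adjacency. *)
Lemma prime_section_iso x' : set_iso e e' [set y | rV U x y] [set y' | rH U x' y'].
Proof.
have /setDP[s0U' s0L] := s0U.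
have [g _ gP] := sim3_step (sim3_any x x'); pose u := x + s0.
have [_ s1 _] := gP u; set u' := g u in s1.
have [h bij_h hP] := sim3_step s1; have injh := bij_inj bij_h.
have hsim w : sim3 e e' x u w x' u' (h w) by case: (hP w).
have rE w : rH U x' (h w) = rV U x w.
  by rewrite /rH; have [_ <- _] := c'P (hsim w); rewrite inCE.
exists h; split; first by move=> y z _ _; apply: injh.
  have [k kK hK] := bij_h; apply/setP=> w'; rewrite -[w'](hK w') (mem_imset _ _ injh).
  by rewrite !inE rE.
move=> b a; rewrite !inE /rV -(opprB b) -(opprB a) !(zmod_opp _ UP) => bU aU0.
have [g2 bij_g2 g2P] := sim3_step (hsim a); have [k2 k2K g2K] := bij_g2.
(* [b2] corresponds to [h b] in the position that also has [a] on the board. Relative to [u], the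
   points [b] and [b2] have the same slope, so they agree modulo [L]; with [u] lifted, the edge from
   [b2] to [a] is compared with its image. *)
pose b2 := k2 (h b); have [_ s2 s3] := g2P b2; rewrite g2K in s2 s3.
have s4 : sim3 e e x u b x u b2 by apply: sim3_trans (hsim b) (sim3_sym s3).
have uU : u - x \in U :\: L by rewrite /u addrC addKr.
have b2U : b2 - x \in U by have [_ <-] := sim3_UL aU' s4.
have b2b : b2 - b \in L.
  have := slope_unique s4 uU bU; have /setDP[u1 u2] := uU.
  have fu : f (u - x) != 0 by rewrite f0.
  move/(congr1 (fun t => t * f (u - x))); rewrite !divfK // => /eqP.
  rewrite feq //; suff -> : b2 - x - (b - x) = b2 - b by [].
  by ring.
have -> : e' (h b) (h a) = e b2 a.
  have [yyz _ _ _ _] := sim3_copy s2.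
  by rewrite (sim3_edge s2).
have [_ _ eq_ba] := sim3_atom s2; rewrite (inj_eq injh) in eq_ba.
rewrite !circ_adjE; apply: aS.
have ab2 : a - b2 \in U.
  have [_ UB] := UP; have -> : a - b2 = (a - x) - (b2 - x) by ring.
  exact: UB.
have eab : a - b = (a - b2) + (b2 - b) by ring.
have [ab2L|ab2L] := boolP (a - b2 \in L); last by rewrite eab Linv.
have abL : a - b \in L by rewrite eab (zmod_add _ LP ab2L).
have [eab2|nab2] := eqVneq b2 a.
  by rewrite eab2 eqxx in eq_ba; rewrite (eqP (esym eq_ba)) eab2.
by apply: monoL; rewrite !inE ?abL ?ab2L andbT subr_eq0 eq_sym // -eq_ba.
Qed.

End PrimeSection.

Lemma prime_section_graph_iso : prime_section_type c -> graph_iso e e'.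
Proof.
case=> U [L [p [f [[p_pr aU aL sLU fP] [Linv mL mC [s0 [r0 [s0U r0U csr]]]]]]]].
apply: (glue aU mC) => x x'.
exact: (prime_section_iso p_pr aU aL sLU fP Linv mL s0U r0U csr).
Qed.

(** The classes of H and K form a grid in [V']. Coordinates are read off on the two lines through a
    base point, and the game bijection at that point turns them into elements of [H] and [K]. *)
Lemma tensor_iso : tensor_type c -> graph_iso e e'.
Proof.
case=> H [K [[aH aK HK0 dec] [mH mK mC]]].
have [HP aH'] := aH; have [KP aK'] := aK; have [H0 HB] := HP; have [K0 KB] := KP.
have capHK z : z \in H -> z \in K -> z = 0.
  by move=> zH zK; apply/eqP; have := subsetP HK0 z; rewrite !inE zH zK; apply.
have /equivalence_relP[Hxx Hl] := rH_equiv aH.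
have /equivalence_relP[Kxx Kl] := rH_equiv aK.
have Hsym x' y' : rH H x' y' = rH H y' x' by apply/idP/idP => /Hl <-.
have Ksym x' y' : rH K x' y' = rH K y' x' by apply/idP/idP => /Kl <-.
have HKeq x' y' : rH H x' y' -> rH K x' y' -> x' = y'.
  rewrite /rH; have [z [<- _ z0]] := edge_color x' y'; rewrite !inCE // => zH zK.
  by apply/eqP; rewrite -z0 (capHK z).
have corner X Y (aX : asubgroup c X) (aY : asubgroup c Y) x' y' :
    (forall z, exists2 w, w \in X & z - w \in Y) ->
    exists w', rH X x' w' && rH Y y' w'.
  case: aX aY => [_ aX] [YP aY] decXY.
  have [x [y [z s]]] := sim3_cover nd x' y' y'; have [f _ fP] := sim3_step s.
  have [w wX xyw] := decXY (x - y).
  have [_ _ /c'P[_ c1 c2]] := fP (x - w); exists (f (x - w)).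
  rewrite /rH -c1 -c2 !inCE // subKr wX /=.
  have -> : y - (x - w) = - (x - y - w) by ring.
  by rewrite (zmod_opp _ YP).
have [x0 _] := sim3_diag nd 0.
have decK z : exists2 w, w \in K & z - w \in H.
  by have [w wH zwK] := dec z; exists (z - w); rewrite // subKr.
(* [p] projects along classes of [K] to the [H]-line of [x0], and [q] along classes of [H] to its
   [K]-line. *)
have /choice[p pP] : forall x', exists w', rH H x0 w' && rH K x' w'.
  by move=> x'; apply: corner.
have /choice[q qP] : forall x', exists w', rH K x0 w' && rH H x' w'.
  by move=> x'; apply: corner.
have [f [g gK fK] fP] := sim3_step (sim3_any 0 x0).
have rfg X w' : aset c X -> rH X x0 w' = (g w' \in X).
  move=> aX; have [_ _ /c'P[_ + _]] := fP (g w'); rewrite fK /rH => <-.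
  by rewrite sub0r inCE // (aset_opp cP _ aX).
have gpH x' : g (p x') \in H by rewrite -rfg //; case/andP: (pP x').
have gqK x' : g (q x') \in K by rewrite -rfg //; case/andP: (qP x').
have qE x' y' : rH H x' y' = (q x' == q y').
  have [/andP[q1 q2] /andP[q3 q4]] := (qP x', qP y').
  apply/idP/eqP => [xy|eq_q]; last by rewrite (Hl _ _ q2) eq_q Hsym.
  apply: HKeq; last by rewrite -(Kl _ _ q1).
  by rewrite -(Hl _ _ q2) (Hl _ _ xy).
have pE x' y' : rH K x' y' = (p x' == p y').
  have [/andP[p1 p2] /andP[p3 p4]] := (pP x', pP y').
  apply/idP/eqP => [xy|eq_p]; last by rewrite (Kl _ _ p2) eq_p Ksym.
  apply: HKeq; first by rewrite -(Hl _ _ p1).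
  by rewrite -(Kl _ _ p2) (Kl _ _ xy).
pose G x' := g (p x') + g (q x').
have GH x' y' : (G x' - G y' \in H) = rH H x' y'.
  have -> : G x' - G y' = (g (p x') - g (p y')) + (g (q x') - g (q y')) by rewrite /G; ring.
  rewrite (zmod_add _ HP (HB _ _ (gpH x') (gpH y'))) qE -(inj_eq (can_inj fK)) -subr_eq0.
  apply/idP/eqP => [h|->//]; apply: capHK h _; exact: KB.
have GK x' y' : (G x' - G y' \in K) = rH K x' y'.
  have -> : G x' - G y' = (g (q x') - g (q y')) + (g (p x') - g (p y')) by rewrite /G; ring.
  rewrite (zmod_add _ KP (KB _ _ (gqK x') (gqK y'))) pE -(inj_eq (can_inj fK)) -subr_eq0.
  apply/idP/eqP => [h|->//]; apply: capHK _ h; exact: HB.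
have injG : injective G.
  by move=> x' y' eG; apply: HKeq; rewrite -?GH -?GK eG subrr.
have eG x' y' : e' x' y' = e (G x') (G y').
  rewrite circ_adj_sym // circ_adjE; set d := G x' - G y'.
  have [z [cz -> z0]] := edge_color x' y'.
  have zH : (z \in H) = (d \in H) by rewrite GH /rH -cz inCE.
  have zK : (z \in K) = (d \in K) by rewrite GK /rH -cz inCE.
  have [z_0|zn0] := eqVneq z 0.
    by rewrite z_0; congr (_ \in S); apply/esym/capHK; rewrite -?zH -?zK z_0.
  have dn0 : d != 0 by apply: contra zn0 => /eqP d0; rewrite (capHK z) ?zH ?zK ?d0.
  apply: aS; have [zinH|znH] := boolP (z \in H).
    by apply: mH; rewrite !inE ?zn0 ?dn0 // -zH.
  have [zinK|znK] := boolP (z \in K).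
    by apply: mK; rewrite !inE ?zn0 ?dn0 // -zK.
  by apply: mC; rewrite !inE negb_or -?zH -?zK znH.
have [G' GK' G'K] := inj_card_bij injG (eq_leq card_VV').
exists G'; split=> [|x y]; first by exists G.
by rewrite eG !G'K.
Qed.

End Color.

Theorem rank4_iso : #|P| = 4 -> graph_iso e e'.
Proof.
rewrite -(card_circ_color connS closP) => rank4; have [c' c'P] := color_ex.
case: (rank4_classification cP rank4).
- exact: prime_section_graph_iso c'P.
- exact: chain_iso c'P.
exact: tensor_iso c'P.
Qed.

End Identify.

Theorem rank4_identified n (S : {set 'I_n}) : (0 < n)%N -> circ_conn S ->
  WL_rank_is (circ_adj S) 4 -> wl_identifies (circ_adj S) 3.
Proof.
case: n S => [|[|n]] S // _ connS [P [closP rank4]]; last first.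
  move=> V' e' simple_e' noniso; apply: contrapT => nd; apply: noniso.
  exact: rank4_iso closP _ _ nd rank4.
(* For order 1 there is a single pair, hence at most one class. *)
have [[partP _] _] := closP.
have [_ _ /negP P0] := and3P partP.
have := card_partition partP; rewrite cardsT card_prod card_ord => card1.
suff : (#|P| <= 1)%N by rewrite rank4.
rewrite -[1%N in X in (_ <= X)%N]muln1 card1 -sum1_card; apply: leq_sum => X XP.
by rewrite card_gt0; apply: contraTneq XP => ->; apply/negP.
Qed.

Local Close Scope ring_scope.
From Stdlib Require Import BinNat.

(** * A Paley-type graph that the two-dimensional algorithm does not identify *)

Lemma count_ord n (P : pred nat) : #|[set w : 'I_n | P w]| = count P (iota 0 n).
Proof.
rewrite -val_enum_ord count_map -size_filter cardE; congr size.
by rewrite /enum_mem -filter_predI; apply: eq_filter => w; rewrite /= !inE andbT.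
Qed.

Lemma all_ord n (P : pred nat) : all P (iota 0 n) -> forall x : 'I_n, P x.
Proof. by move/allP=> h x; apply: h; rewrite mem_iota /= ltn_ord. Qed.

Lemma all_ord2 n (P : nat -> nat -> bool) :
  all (fun x => all (P x) (iota 0 n)) (iota 0 n) -> forall x y : 'I_n, P x y.
Proof. by move=> h x y; apply: (all_ord (all_ord h x)). Qed.

(* Pair types on 58 = 2 * 29 vertices, two vertices being twins when they agree mod 29:
   (true, b) for equal (b) or twin (~~ b) vertices, (false, b) for pairs of distinct blocks,
   where b tells whether they are adjacent in the graph A on 29 vertices. *)
Definition pair_type (A : nat -> nat -> bool) (x y : nat) : bool * bool :=
  if x %% 29 == y %% 29 then (true, x == y) else (false, A (x %% 29) (y %% 29)).

Definition type_edge (t : bool * bool) : bool := if t.1 then ~~ t.2 else t.2.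

Definition paley29 (i j : nat) : bool :=
  (j + 29 - i) %% 29 \in [:: 1; 4; 5; 6; 7; 9; 13; 16; 20; 22; 23; 24; 25; 28].

(* Another strongly regular graph with the parameters (29, 14, 6, 7) of the Paley graph;
   the binary digits of the i-th number are the i-th row of its adjacency matrix. *)
Definition srg29 (i j : nat) : bool :=
  N.testbit (nth 0%num [::
    103114612; 479768948; 378303115; 525730484; 353572683; 443859275; 90370227;
    33186636; 148457139; 195073437; 409877265; 535917568; 323538518; 222039239;
    298129893; 196022882; 127846673; 351110360; 420209709; 39302534; 321464762;
    311602913; 235560424; 472107910; 135658200; 75078189; 180562015; 96775978;
    11951166]%num i) (bin_of_nat j).

Definition type_code (t : bool * bool) : nat :=
  match t with (false, false) => 0 | (false, true) => 1 | (true, false) => 2 | (true, true) => 3 end.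

Definition intersection_number (t s u : bool * bool) : nat :=
  nth 0 (nth [::] (nth [::]
    [:: [:: [:: 12; 14; 1; 1]; [:: 14; 14; 0; 0]; [:: 1; 0; 0; 0]; [:: 1; 0; 0; 0]];
        [:: [:: 14; 14; 0; 0]; [:: 14; 12; 1; 1]; [:: 0; 1; 0; 0]; [:: 0; 1; 0; 0]];
        [:: [:: 28; 0; 0; 0]; [:: 0; 28; 0; 0]; [:: 0; 0; 0; 1]; [:: 0; 0; 1; 0]];
        [:: [:: 28; 0; 0; 0]; [:: 0; 28; 0; 0]; [:: 0; 0; 1; 0]; [:: 0; 0; 0; 1]]]
    (type_code t)) (type_code s)) (type_code u).

Definition all_types := [:: (false, false); (false, true); (true, false); (true, true)].

Definition type_table (A : nat -> nat -> bool) : seq (seq (bool * bool)) :=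
  [seq [seq pair_type A x y | y <- iota 0 58] | x <- iota 0 58].

(* A reduced form of the boolean equality, so that the tables below evaluate quickly. *)
Definition type_eqb (s t : bool * bool) : bool :=
  let: (s1, s2) := s in let: (t1, t2) := t in
  if s1 then (if t1 then (if s2 then t2 else ~~ t2) else false)
  else (if t1 then false else (if s2 then t2 else ~~ t2)).

Lemma type_eqbE s t : type_eqb s t = (s == t).
Proof. by case: s t => [[] []] [[] []]. Qed.

(** Written as an application so that call-by-value evaluation builds the table once, and the flags
    once for each [x] and [s]. *)
Definition check_table (A : nat -> nat -> bool) : bool :=
  (fun tbl => all (fun x => all (fun s =>
     (fun flags => all (fun y => all (fun u =>
        count (fun p => p.1 && type_eqb p.2 u) (zip flags (nth [::] tbl y))
        == intersection_number (nth s (nth [::] tbl x) y) s u) all_types) (iota 0 58))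
     [seq type_eqb t s | t <- nth [::] tbl x]) all_types) (iota 0 58)) (type_table A).

(** The degree 29 is 2 * 14 plus the twin. Adjacent vertices of distinct blocks share 2 * 6 vertices
    and their two twins, nonadjacent ones 2 * 7: the agreement of these numbers gives the Deza
    property. *)
Definition common_number (t : bool * bool) : nat :=
  if t.1 then (if t.2 then 29 else 28) else 14.

Definition check_common (A : nat -> nat -> bool) : bool :=
  (fun tbl => all (fun x => all (fun y =>
     count (fun p => type_edge p.1 && type_edge p.2) (zip (nth [::] tbl x) (nth [::] tbl y))
     == common_number (nth (true, true) (nth [::] tbl x) y)) (iota 0 58)) (iota 0 58))
  (type_table A).

Definition check_sym (A : nat -> nat -> bool) : bool :=
  all (fun x => all (fun y => pair_type A x y == pair_type A y x) (iota 0 58)) (iota 0 58).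

Lemma nth_table A x : x < 58 -> nth [::] (type_table A) x = [seq pair_type A x y | y <- iota 0 58].
Proof. by move=> ltx; rewrite (nth_map 0) ?size_iota // nth_iota. Qed.

Lemma nth_row A x y t : y < 58 -> nth t [seq pair_type A x y | y <- iota 0 58] y = pair_type A x y.
Proof. by move=> lty; rewrite (nth_map 0) ?size_iota // nth_iota. Qed.

Lemma count_zip (T U : Type) (f : nat -> T) (g : nat -> U) (P : pred (T * U)) l :
  count P (zip (map f l) (map g l)) = count (fun w => P (f w, g w)) l.
Proof. by elim: l => //= x l ->. Qed.

Record type_scheme (A : nat -> nat -> bool) : Prop := TypeScheme {
  scheme_table : check_table A;
  scheme_common : check_common A;
  scheme_sym : check_sym A }.

Lemma paley_scheme : type_scheme paley29.
Proof. by split; vm_compute. Qed.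

Lemma srg_scheme : type_scheme srg29.
Proof. by split; vm_compute. Qed.

Local Notation V := 'I_58.

Definition blowup (A : nat -> nat -> bool) : rel V := fun x y => type_edge (pair_type A x y).

Section Scheme.
Variable A : nat -> nat -> bool.
Hypothesis sA : type_scheme A.

Lemma pair_type_sym (x y : V) : pair_type A x y = pair_type A y x.
Proof. by have /eqP := all_ord2 (scheme_sym sA) x y. Qed.

Lemma pair_type_eq (x y : V) : (pair_type A x y == (true, true)) = (x == y).
Proof.
rewrite /pair_type; case: (x %% 29 =P y %% 29) => [_|ne]; first by rewrite xpair_eqE eqxx eqb_id.
by apply/esym/negbTE/eqP=> e; apply: ne; rewrite e.
Qed.

Lemma pair_typexx (x : V) : pair_type A x x = (true, true).
Proof. by apply/eqP; rewrite pair_type_eq. Qed.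

Lemma card_types (x y : V) s u :
  #|[set w : V | (pair_type A x w == s) && (pair_type A y w == u)]| =
  intersection_number (pair_type A x y) s u.
Proof.
have := all_ord (scheme_table sA) x; have sT : s \in all_types by case: s => [[] []].
have uT : u \in all_types by case: u => [[] []].
move/allP/(_ s sT) => /all_ord/(_ y) /allP/(_ u uT)/eqP.
rewrite !nth_table // nth_row // -map_comp count_zip => <-.
rewrite (count_ord 58 (fun w => (pair_type A x w == s) && (pair_type A y w == u))).
by apply: eq_count => w /=; rewrite !type_eqbE.
Qed.

Lemma card_common (x y : V) :
  #|[set w : V | blowup A x w && blowup A y w]| = common_number (pair_type A x y).
Proof.
have := all_ord2 (scheme_common sA) x y => /eqP.
rewrite !nth_table // nth_row // count_zip => <-.
exact: (count_ord 58 (fun w => type_edge (pair_type A x w) && type_edge (pair_type A y w))).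
Qed.

Lemma blowup_sym (x y : V) : blowup A x y = blowup A y x.
Proof. by rewrite /blowup pair_type_sym. Qed.

Lemma blowup_simple : simple_graph (blowup A).
Proof. by split=> [x y|x]; [apply: blowup_sym|rewrite /blowup pair_typexx]. Qed.

Lemma blowup_Deza : is_Deza (blowup A).
Proof.
split.
  exists 29 => x; rewrite -[RHS]/(common_number (true, true)) -(pair_typexx x) -card_common.
  by apply: eq_card => w; rewrite !inE andbb.
exists 28, 14 => x y; rewrite -(pair_type_eq x y) card_common.
by case: (pair_type A x y) => [[] []]; auto.
Qed.

End Scheme.

(** Both schemes have the same intersection numbers, so joint types over the two pairs are equally
    frequent. This answers any move against two pebbles. *)
Lemma scheme_match A B (x y x2 y2 : V) : type_scheme A -> type_scheme B ->
  pair_type A x y = pair_type B x2 y2 -> exists2 f : V -> V, bijective f &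
    forall w : V, pair_type A x w = pair_type B x2 (f w) /\ pair_type A y w = pair_type B y2 (f w).
Proof.
move=> sA sB xy.
have [p|f bij_f fE] := @fun_of_fibers V V (((bool * bool) * (bool * bool))%type : finType)
  (fun w => (pair_type A x w, pair_type A y w)) (fun w => (pair_type B x2 w, pair_type B y2 w)).
  transitivity (intersection_number (pair_type A x y) p.1 p.2); [|rewrite xy];
  by rewrite -card_types //; apply: eq_card => w; rewrite !inE -pair_eqE /= /pair_eq.
by exists f => // w; have [<- <-] := fE w.
Qed.

Section Rank.
Variable A : nat -> nat -> bool.
Hypothesis sA : type_scheme A.

Definition type_rel : rel (V * V) := fun p q => pair_type A p.1 p.2 == pair_type A q.1 q.2.

Lemma type_rel_coherent : coherent_rel type_rel.
Proof.
split.
- by apply/equivalence_relP; split=> [p|p q /eqP pq r]; rewrite /type_rel ?eqxx ?pq.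
- by move=> p q /eqP pq; rewrite -!(pair_type_eq A) pq.
- by move=> x y x2 y2; rewrite /type_rel /= (pair_type_sym sA y) (pair_type_sym sA y2).
move=> x y x2 y2 /eqP /= xy; have [f bij_f fP] := scheme_match sA sA xy.
exists f => [|w]; first exact: bij_inj.
have [e1 e2] := fP w; rewrite /type_rel /= e1 eqxx; split=> //.
by rewrite pair_type_sym // e2 pair_type_sym.
Qed.

Definition type_classes : {set {set V * V}} := equivalence_partition type_rel setT.

(** Equality, adjacency and the number of common neighbours are constant on each class of a
    competing configuration, and they determine the type: 28 against 14 separates twins from other
    neighbours. *)
Lemma blowup_closure : is_WL_closure (blowup A) type_classes.
Proof.
split; first exact: coherent_rel_config type_rel_coherent.
split.
  by apply: coherent_rel_union => -[x y] [x2 y2] /eqP /= xy; rewrite !inE /blowup /= xy.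
move=> Q cohQ unQ Y YQ; have [partQ [unD [_ counts]]] := cohQ.
have [_ _ /negP Q0] := and3P partQ.
have /set0Pn[[x y] xyY] : Y != set0 by apply: contraTneq YQ => ->; apply/negP.
exists [set q | type_rel (x, y) q].
  by apply/imsetP; exists (x, y) => //; apply/setP=> q; rewrite !inE.
have unE (X : {set V * V}) : union_of_classes Q X -> forall p q, p \in Y -> q \in Y ->
    (p \in X) = (q \in X).
  move=> unX p q pY qY; case: (unX Y YQ) => [/subsetP sYX|dYX]; first by rewrite !sYX.
  by rewrite !(disjointFr dYX).
apply/subsetP=> -[x2 y2] x2y2Y; rewrite inE /type_rel /=.
have eqE : (x == y) = (x2 == y2) by have := unE _ unD _ _ xyY x2y2Y; rewrite !inE.
have edgeE : blowup A x y = blowup A x2 y2 by have := unE _ unQ _ _ xyY x2y2Y; rewrite !inE.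
have commE : common_number (pair_type A x y) = common_number (pair_type A x2 y2).
  have cardE (a b : V) : common_number (pair_type A a b) =
      #|[set g | ((a, g) \in edge_set (blowup A)) && ((g, b) \in edge_set (blowup A))]|.
    by rewrite -card_common //; apply: eq_card => w; rewrite !inE /= (blowup_sym sA w).
  by rewrite !cardE; apply: (coherent_count cohQ unQ unQ YQ xyY x2y2Y).
move: eqE edgeE commE; rewrite -!(pair_type_eq A) /blowup.
by case: (pair_type A x y) (pair_type A x2 y2) => [[] []] [[] []].
Qed.

Lemma card_type_classes : #|type_classes| = 4.
Proof.
pose F (t : bool * bool) := [set q : V * V | pair_type A q.1 q.2 == t].
have wit t : exists p : V * V, pair_type A p.1 p.2 = t.
  have /card_gt0P[w wP] :
      0 < #|[set w : V | (pair_type A (@ord0 57) w == t) && (pair_type A (@ord0 57) w == t)]|.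
    by rewrite card_types // pair_typexx; case: t => [[] []].
  by exists (ord0, w); move: wP; rewrite inE => /andP[/eqP].
have injF : injective F.
  move=> t u e; have [p pt] := wit t; have : p \in F t by rewrite inE pt.
  by rewrite e inE pt => /eqP.
suff -> : type_classes = F @: [set: bool * bool] by rewrite card_imset // cardsT card_prod card_bool.
apply/setP=> X; apply/imsetP/imsetP => [[p _ ->]|[t _ ->]].
  exists (pair_type A p.1 p.2) => //; apply/setP=> q; rewrite !inE /type_rel /=.
  by rewrite eq_sym.
have [p pt] := wit t; exists p => //; apply/setP=> q; rewrite !inE /type_rel /=.
by rewrite pt eq_sym.
Qed.

Lemma blowup_rank : WL_rank_is (blowup A) 4.
Proof. by exists type_classes; split; [apply: blowup_closure|apply: card_type_classes]. Qed.

End Rank.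

(** * Indistinguishability with at most two pebbles *)

Section Pebbles.
Variables A B : nat -> nat -> bool.
Hypothesis sA : type_scheme A.
Hypothesis sB : type_scheme B.

Let compatible m (u v : {ffun 'I_m -> V}) : Prop :=
  forall i j, pair_type A (u i) (u j) = pair_type B (v i) (v j).

Lemma compatible_wl_eq m : 0 < m < 3 -> forall k (u v : {ffun 'I_m -> V}),
  compatible u v -> wl_eq (blowup A) (blowup B) k u v.
Proof.
move=> m_range; have atom (x y x2 y2 : V) : pair_type A x y = pair_type B x2 y2 ->
    (x == y) = (x2 == y2) /\ blowup A x y = blowup B x2 y2.
  by move=> e; rewrite -(pair_type_eq A) -(pair_type_eq B) /blowup e.
elim=> [|k IH] u v uv; first by move=> i j; apply/atom/uv.
split; first exact: IH.
have [f bij_f fP] : exists2 f : V -> V, bijective f &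
    forall i (w : V), pair_type A (u i) w = pair_type B (v i) (f w).
  case: m m_range u v uv {IH} => [|[|[|m]]] // _ u v uv.
    have [f bij_f fP] := scheme_match sA sB (uv ord0 ord0).
    by exists f => // i w; rewrite ord1; case: (fP w).
  have [f bij_f fP] := scheme_match sA sB (uv ord0 ord_max).
  exists f => // i w; have [e0 e1] := fP w.
  by case: (unliftP ord_max i) => [j ->|-> //]; rewrite ord1 (_ : lift _ _ = ord0) //; apply: val_inj.
exists f; split=> // w; split=> [i|j].
  have [e1 e2] := atom _ _ _ _ (fP i w).
  by rewrite e1 e2; split=> //; split=> //; rewrite blowup_sym // e2 blowup_sym.
apply: IH => i i2; rewrite !ffunE; case: eqP => _; case: eqP => _ //.
- by rewrite !pair_typexx.
by rewrite pair_type_sym // fP pair_type_sym.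
Qed.

Lemma not_distinguished_blowup m : 0 < m < 3 -> ~ wl_distinguishes (blowup A) (blowup B) m.
Proof.
move=> m_range [k]; apply.
have /choice[h hP] : forall x : V, exists f : V -> V, bijective f /\
    forall w : V, pair_type A x w = pair_type B x (f w).
  move=> x; have [|f bij_f fP] := @scheme_match A B x x x x sA sB; first by rewrite !pair_typexx.
  by exists f; split=> // w; case: (fP w).
have hx x : h x x = x.
  have [_ /(_ x)] := hP x; rewrite pair_typexx => /esym/eqP.
  by rewrite pair_type_eq => /eqP <-.
case: m m_range => [|[|[|m]]] // m_range.
  exists id; split=> [|u]; first by exists id.
  by apply: compatible_wl_eq => // i j; rewrite (ord1 i) (ord1 j) !pair_typexx.
(* Since [h x x = x], the first coordinate is kept; it selects the bijection applied to the second,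
   so [g] is injective. *)
pose g (u : {ffun 'I_2 -> V}) : {ffun 'I_2 -> V} := [ffun i => h (u ord0) (u i)].
exists g; split=> [|u].
  apply: injF_bij => u v /ffunP e; apply/ffunP=> i.
  have e0 : u ord0 = v ord0 by have := e ord0; rewrite !ffunE !hx.
  by have := e i; rewrite !ffunE e0; apply: bij_inj; case: (hP (v ord0)).
apply: compatible_wl_eq => // i j; rewrite !ffunE.
have i01 (i' : 'I_2) : i' = ord0 \/ i' = ord_max.
  by case: (unliftP ord_max i') => [j' ->|->]; [left; rewrite ord1; apply: val_inj|right].
have [_ hu] := hP (u ord0).
case: (i01 i) (i01 j) => [] -> [] ->; rewrite ?hx ?pair_typexx ?hu //.
by rewrite [LHS]pair_type_sym // hu pair_type_sym.
Qed.

End Pebbles.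

(** For a simple graph, twice the number of edges in the common neighbourhood, each being counted
    from both ends. *)
Definition common_edges (W : finType) (e : rel W) (x y : W) : nat :=
  \sum_(z | e x z && e y z) #|[set w | [&& e x w, e y w & e z w]]|.

Lemma common_edges_iso (W W' : finType) (e : rel W) (e' : rel W') (h : W -> W') x y :
  bijective h -> (forall u v, e u v = e' (h u) (h v)) ->
  common_edges e x y = common_edges e' (h x) (h y).
Proof.
move=> bij_h eh; have injh := bij_inj bij_h; have [k hK kK] := bij_h.
rewrite /common_edges [RHS](reindex h) /=; last exact: onW_bij.
apply: eq_big => [z|z _]; first by rewrite !eh.
rewrite -(card_imset _ injh); apply: eq_card => w'; rewrite -(kK w').
by rewrite (mem_imset _ _ injh) !inE !eh.
Qed.

Definition common_edges_nat (A : nat -> nat -> bool) (x y : nat) : nat :=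
  (fun N => sumn [seq count (fun w => type_edge (pair_type A z w)) N | z <- N])
  [seq z <- iota 0 58 | type_edge (pair_type A x z) && type_edge (pair_type A y z)].

Lemma common_edgesE A (x y : V) : common_edges (blowup A) x y = common_edges_nat A x y.
Proof.
rewrite /common_edges /common_edges_nat sumnE big_map big_filter.
rewrite -[iota 0 58]/(index_iota 0 58) [RHS]big_mkord; apply: eq_bigr => z _.
rewrite count_filter -count_ord; apply: eq_card => w; rewrite !inE /blowup /=.
by rewrite andbA andbC.
Qed.

(** 102 is the value of the other graph at its edge from 0 to 2. By translation, only the edges at 0
    need inspection on the Paley side. *)
Lemma paley_common_edges :
  all (fun y => type_edge (pair_type paley29 0 y) ==> (common_edges_nat paley29 0 y != 102))
    (iota 0 58).
Proof. by vm_compute. Qed.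

Lemma srg_common_edges :
  type_edge (pair_type srg29 0 2) && (common_edges_nat srg29 0 2 == 102).
Proof. by vm_compute. Qed.

Definition paley58 : {set V} := [set s : V | type_edge (pair_type paley29 0 s)].

Lemma paley58_translation :
  all (fun x => all (fun y => type_edge (pair_type paley29 0 ((y + (58 - x)) %% 58))
    == type_edge (pair_type paley29 x y)) (iota 0 58)) (iota 0 58).
Proof. by vm_compute. Qed.

Lemma circ_paley58 : circ_adj paley58 = blowup paley29.
Proof.
apply/funext=> x; apply/funext=> y; rewrite circ_adjE inE /blowup /=.
have /eqP <- := all_ord2 paley58_translation x y.
by rewrite modnDmr.
Qed.

Lemma paley58_conn : circ_conn paley58.
Proof.
split=> [s|s]; rewrite inE; first by apply: contraTneq => ->.
move=> sE; exists (- s)%R; last by rewrite /= modnDmr subnKC ?modnn // ltnW.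
have := circ_adjE paley58 s 0%R; rewrite GRing.sub0r => <-.
by rewrite circ_paley58 (blowup_sym paley_scheme).
Qed.

Lemma blowup_not_iso : ~ graph_iso (blowup paley29) (blowup srg29).
Proof.
case=> h [bij_h eh]; have /andP[e02 /eqP c02] := srg_common_edges.
have [k hK kK] := bij_h; pose x := k (@Ordinal 58 0 isT); pose y := k (@Ordinal 58 2 isT).
have exy : blowup paley29 x y by rewrite eh !kK.
have cxy : common_edges (blowup paley29) x y = 102.
  by rewrite (common_edges_iso x y bij_h eh) !kK common_edgesE.
have trans u v : blowup paley29 u v = blowup paley29 (u - x)%R (v - x)%R.
  rewrite -circ_paley58 !circ_adjE.
  by rewrite (_ : (v - x - (u - x) = v - u)%R) // GRing.opprB GRing.addrA GRing.subrK.
have bij_t : bijective (fun u : V => (u - x)%R).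
  by exists (fun u => (u + x)%R) => u; rewrite ?GRing.addrK ?GRing.subrK.
have := all_ord paley_common_edges (y - x)%R => /implyP.
have := common_edgesE paley29 (x - x)%R (y - x)%R.
rewrite -(common_edges_iso x y bij_t trans) cxy GRing.subrr => <-.
by move=> ne; move: exy; rewrite trans GRing.subrr => /ne.
Qed.

Theorem theorem1p2 :
  (forall (n : nat) (S : {set 'I_n}),
      0 < n -> circ_conn S -> is_Deza (circ_adj S) -> WL_rank_is (circ_adj S) 4 ->
      exists2 m, WL_dim_is (circ_adj S) m & m <= 3) /\
  (exists (n : nat) (S : {set 'I_n}),
      [/\ 0 < n, circ_conn S, is_Deza (circ_adj S), WL_rank_is (circ_adj S) 4
        & WL_dim_is (circ_adj S) 3]).
Proof.
split=> [n S n0 connS _ rank4|].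
  have id3 := rank4_identified n0 connS rank4.
  have ex_m : exists m, (0 < m) && `[< wl_identifies (circ_adj S) m >].
    by exists 3; rewrite /=; apply/asboolP.
  case: (ex_minnP ex_m) => m /andP[m0 /asboolP idm] min_m; exists m.
    split=> //; split=> // m' /andP[m'0 lt_m'm] idm'.
    by have := min_m m'; rewrite m'0 leqNgt lt_m'm => /(_ (introT (asboolP _) idm')).
  by apply: min_m; apply/asboolP.
have rank4 := blowup_rank paley_scheme; rewrite -circ_paley58 in rank4.
exists 58, paley58; split=> //.
- exact: paley58_conn.
- by rewrite circ_paley58; apply: blowup_Deza paley_scheme.
split=> //; split=> [|m m_range]; first exact: rank4_identified paley58_conn rank4.
rewrite circ_paley58 => /(_ _ _ (blowup_simple srg_scheme) blowup_not_iso).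
exact: not_distinguished_blowup paley_scheme srg_scheme _ m_range.
Qed.
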